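(* Let $SU(2)$ be identified with $S^3=\{(a,c)\in\mathbb C^2 : |a|^2+|c|^2=1\}$, let $X=SU(2)/\!\sim$ be the quotient space described in the context, and let $\widehat{C(SU_{-1}(2))}$ denote the spectrum of $C(SU_{-1}(2))$. Then the map $$\Pi: X\longrightarrow \widehat{C(SU_{-1}(2))},\qquad [(a,c)]\mapsto[\pi_{(a,c)}],$$ which is a well-defined bijection, is a homeomorphism of $X$ onto the spectrum of $C(SU_{-1}(2))$.
   Context: $C(SU_{-1}(2))$ is the universal unital $C^*$-algebra with generators $\alpha,\gamma$ subject to the relations $\alpha^*\alpha+\gamma^*\gamma=1$, $\alpha\alpha^*+\gamma\gamma^*=1$, $\alpha\gamma=-\gamma\alpha$, $\alpha\gamma^*=-\gamma^*\alpha$, $\gamma\gamma^*=\gamma^*\gamma$. For $(a,c)\in SU(2)$ (i.e. $a,c\in\mathbb C$, $|a|^2+|c|^2=1$) define a representation $\pi_{(a,c)}$ of $C(SU_{-1}(2))$ as follows. If $c=0$: $\pi_{(a,0)}:C(SU_{-1}(2))\to\mathbb C$, $\alpha\mapsto a$, $\gamma\mapsto 0$. If $a=0$: $\pi_{(0,c)}:C(SU_{-1}(2))\to\mathbb C$, $\alpha\mapsto 0$, $\gamma\mapsto c$. If $ac\neq0$: $\pi_{(a,c)}:C(SU_{-1}(2))\to M_2(\mathbb C)$, $\alpha\mapsto\begin{pmatrix}a&0\\0&-a\end{pmatrix}$, $\gamma\mapsto\begin{pmatrix}0&c\\c&0\end{pmatrix}$. Each of these representations is surjective, hence irreducible. The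 equivalence relation $\sim$ on $SU(2)$: if $ac\neq 0$, then $(a,c)\sim(b,d)$ if and only if $(b,d)\in\{(a,c),(-a,c),(a,-c),(-a,-c)\}$; if $a=0$ or $c=0$, the equivalence class of $(a,c)$ consists of the single element $(a,c)$. The space $X=SU(2)/\!\sim$ carries the quotient (final) topology with respect to the canonical projection $SU(2)\to X$. The spectrum $\widehat{A}$ of a $C^*$-algebra $A$ is the set of unitary equivalence classes of irreducible representations, with the topology pulled back from the Jacobson (hull-kernel) topology on $\operatorname{Prim}(A)$ along $[\pi]\mapsto\ker\pi$ (for $A=C(SU_{-1}(2))$ this map to $\operatorname{Prim}(A)$ is a bijection). *)

(* Defs.v *)
From HB Require Import structures.
From mathcomp Require Import all_boot all_order all_algebra.
From mathcomp Require Import all_classical all_reals all_analysis.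
From mathcomp Require Import complex.

Set Implicit Arguments.
Unset Strict Implicit.
Unset Printing Implicit Defensive.

Import Order.TTheory GRing.Theory Num.Theory.
Import numFieldNormedType.Exports.

Local Open Scope classical_set_scope.
Local Open Scope quotient_scope.
Local Open Scope complex_scope.
Local Open Scope ring_scope.

(* [complex R] is not of the form [Num.NumField.sort _], so the norm topology
   that numFieldNormedType puts on every numFieldType has to be transported
   to R[i] by hand. *)
HB.instance Definition _ (R : realType) := GRing.ComAlgebra.copy R[i] R[i]^o.
HB.instance Definition _ (R : realType) := Vector.copy R[i] R[i]^o.
HB.instance Definition _ (R : realType) := NormedModule.copy R[i] R[i]^o.

(* Hierarchy Builder does not allow a join of algType with normedModType, so the
   norm and completeness are part of the mixin. As for normed modules over R[i],
   the norm takes its values in R[i]; cnormD and cnormZ force them to be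
   nonnegative reals. As every algType, a C*-algebra is nonzero here. *)
HB.mixin Record isCStarAlgebra (R : realType) A of GRing.Algebra R[i] A := {
  cnorm : A -> R[i];
  star : A -> A;
  cnormD : forall x y, cnorm (x + y) <= cnorm x + cnorm y;
  cnormZ : forall (z : R[i]) x, cnorm (z *: x) = `|z| * cnorm x;
  cnorm_eq0 : forall x, cnorm x = 0 -> x = 0;
  cnormM : forall x y, cnorm (x * y) <= cnorm x * cnorm y;
  cnorm_complete : forall u : nat -> A,
    (forall e : R[i], 0 < e -> exists N, forall m n,
       (N <= m)%N -> (N <= n)%N -> cnorm (u m - u n) < e) ->
    exists l, forall e : R[i], 0 < e -> exists N, forall n,
       (N <= n)%N -> cnorm (u n - l) < e;
  starK : involutive star;
  starD : {morph star : x y / x + y};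
  starZ : forall (z : R[i]) x, star (z *: x) = z^* *: star x;
  starM : forall x y, star (x * y) = star y * star x;
  cstar_identity : forall x, cnorm (star x * x) = cnorm x ^+ 2
}.

#[short(type="cstarAlgType")]
HB.structure Definition CStarAlgebra (R : realType) :=
  {A of GRing.Algebra R[i] A & isCStarAlgebra R A}.

(* [inner] is linear in its first argument, conjugate linear in the second. *)
HB.mixin Record isHilbert (R : realType) H of CompleteNormedModule R[i] H := {
  inner : {dot H for Num.conj};
  sqr_norm_inner : forall v : H, `|v| ^+ 2 = inner v v
}.

#[short(type="hilbertType")]
HB.structure Definition Hilbert (R : realType) :=
  {H of CompleteNormedModule R[i] H & isHilbert R H}.

Section SUm1.
Variable R : realType.

Definition SUm1_relations (A : cstarAlgType R) (alpha gamma : A) : Prop :=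
  [/\ star alpha * alpha + star gamma * gamma = 1,
      alpha * star alpha + gamma * star gamma = 1,
      alpha * gamma = - (gamma * alpha),
      alpha * star gamma = - (star gamma * alpha) &
      gamma * star gamma = star gamma * gamma].

(* (A, alpha, gamma) is the universal unital C*-algebra of the relations above;
   [{lrmorphism A -> B}] is the type of unital algebra morphisms. *)
Definition is_C_SUm1_2 (A : cstarAlgType R) (alpha gamma : A) : Prop :=
  SUm1_relations alpha gamma /\
  forall (B : cstarAlgType R) (a c : B), SUm1_relations a c ->
    (exists f : {lrmorphism A -> B},
       [/\ {morph f : x / star x}, f alpha = a & f gamma = c]) /\
    (forall f g : {lrmorphism A -> B},
       [/\ {morph f : x / star x}, f alpha = a & f gamma = c] ->
       [/\ {morph g : x / star x}, g alpha = a & g gamma = c] ->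
       f =1 g).

End SUm1.

Section Representations.
Variables (R : realType) (A : cstarAlgType R).

(* *-homomorphisms from A to the bounded operators on H, not assumed unital. *)
Record representation (H : hilbertType R) := Representation {
  rep :> A -> H -> H;
  rep_linear : forall x, linear (rep x);
  rep_bounded : forall x, continuous (rep x);
  rep_linearl : forall v, linear (rep^~ v);
  repM : forall x y v, rep (x * y) v = rep x (rep y v);
  rep_star : forall x u v, inner (rep x u) v = inner u (rep (star x) v)
}.

Definition invariant_subspace (H : hilbertType R) (rho : representation H)
    (K : set H) : Prop :=
  [/\ K 0, forall (z : R[i]) u v, K u -> K v -> K (z *: u + v) &
      forall x v, K v -> K (rho x v)].

Definition irreducible (H : hilbertType R) (rho : representation H) : Prop :=
  (exists x v, rho x v <> 0) /\
  forall K : set H, invariant_subspace rho K -> closed K ->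
    K = [set 0] \/ K = setT.

Definition unitary_equiv (H1 H2 : hilbertType R)
    (rho1 : representation H1) (rho2 : representation H2) : Prop :=
  exists U : H1 -> H2,
    [/\ linear U, forall w, exists v, U v = w,
        forall u v, inner (U u) (U v) = inner u v &
        forall x v, U (rho1 x v) = rho2 x (U v)].

Record irrep := Irrep {
  irrep_space : hilbertType R;
  irrep_rep :> representation irrep_space;
  irrep_irr : irreducible irrep_rep
}.

Lemma unitary_equiv_refl H (rho : representation H) : unitary_equiv rho rho.
Proof. by exists idfun; split=> // w; exists w. Qed.

Lemma inner_diff_eq0 (H : hilbertType R) (u v : H) :
  inner (u - v) (u - v) = 0 -> u = v.
Proof. by move/eqP; rewrite dnorm_eq0 subr_eq0 => /eqP. Qed.

Lemma unitary_equiv_sym H1 H2 (rho1 : representation H1)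
    (rho2 : representation H2) :
  unitary_equiv rho1 rho2 -> unitary_equiv rho2 rho1.
Proof.
move=> [U [Ulin Usurj Uisom Urep]].
have [V UK] := choice Usurj.
have UB u v : U (u - v) = U u - U v.
  by rewrite addrC -scaleN1r Ulin scaleN1r addrC.
have Uinj : injective U.
  move=> u v Uuv; apply: inner_diff_eq0.
  by rewrite -Uisom UB Uuv subrr; apply/eqP; rewrite dnorm_eq0.
exists V; split=> [z u v|w|u v|x v].
- by apply: Uinj; rewrite Ulin !UK.
- by exists (U w); apply: Uinj; rewrite UK.
- by rewrite -Uisom !UK.
- by apply: Uinj; rewrite Urep !UK.
Qed.

Lemma unitary_equiv_trans H1 H2 H3 (rho1 : representation H1)
    (rho2 : representation H2) (rho3 : representation H3) :
  unitary_equiv rho1 rho2 -> unitary_equiv rho2 rho3 -> unitary_equiv rho1 rho3.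
Proof.
move=> [U [Ulin Usurj Uisom Urep]] [V [Vlin Vsurj Visom Vrep]].
exists (V \o U); split=> [z u v|w|u v|x v] /=.
- by rewrite Ulin Vlin.
- by have [v <-] := Vsurj w; have [u <-] := Usurj v; exists u.
- by rewrite Visom Uisom.
- by rewrite Urep Vrep.
Qed.

(* [irrep] quantifies over all Hilbert spaces, so it lies in a universe that is
   too large for eqType, hence for {eq_quot _} and topologicalType: equivalence
   classes are given as predicates, and the topology of the spectrum as a
   family of open sets. *)
Definition spectrum : Type :=
  {S : irrep -> Prop |
    exists p : irrep, S = (fun q : irrep => unitary_equiv p q)}.

Definition irrep_class (p : irrep) : spectrum :=
  exist _ (fun q : irrep => unitary_equiv p q) (ex_intro _ p erefl).

Lemma irrep_classP (p q : irrep) :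
  irrep_class p = irrep_class q <-> unitary_equiv p q.
Proof.
split=> [/(congr1 sval)/= pq|pq].
  by have := unitary_equiv_refl q; rewrite -[X in X -> _]/((fun r : irrep =>
    unitary_equiv q r) q) -pq.
apply: eq_exist; apply/funext => r; apply/propext.
split; apply: unitary_equiv_trans => //.
exact: unitary_equiv_sym.
Qed.

Definition rep_kernel (H : hilbertType R) (rho : representation H) : set A :=
  [set x | forall v, rho x v = 0].

Definition Prim := {I : set A | exists p : irrep, I = rep_kernel p}.

HB.instance Definition _ := gen_eqMixin Prim.
HB.instance Definition _ := gen_choiceMixin Prim.

Definition prim_of_irrep (p : irrep) : Prim :=
  exist _ (rep_kernel p) (ex_intro _ p erefl).

(* The Jacobson closure of S: the hull of the kernel of S. *)
Definition hull_kernel (S : set Prim) : set Prim :=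
  [set P | \bigcap_(Q in S) sval Q `<=` sval P].

Definition jacobson_open (U : set Prim) : Prop := hull_kernel (~` U) = ~` U.

Lemma sub_hull_kernel S : S `<=` hull_kernel S.
Proof. by move=> P SP x; apply. Qed.

Lemma hull_kernelS S T : S `<=` T -> hull_kernel S `<=` hull_kernel T.
Proof. by move=> ST P SP x Tx; apply: SP => Q /ST; apply: Tx. Qed.

Lemma jacobson_openP U : jacobson_open U <-> hull_kernel (~` U) `<=` ~` U.
Proof.
by split=> [->//|h]; apply/seteqP; split=> //; apply: sub_hull_kernel.
Qed.

Lemma rep0r (H : hilbertType R) (rho : representation H) x : rho x 0 = 0.
Proof.
have := rep_linear rho x (-1) 0 0.
by rewrite scaleN1r addNr scaleN1r addNr.
Qed.

Lemma closed_rep_ker (H : hilbertType R) (rho : representation H) x :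
  closed [set v | rho x v = 0].
Proof.
rewrite [X in closed X](_ : _ = rho x @^-1` [set 0])//.
apply: preimage_closed; last first.
  exact/accessible_closed_set1/hausdorff_accessible/norm_hausdorff.
by move=> v _; apply: rep_bounded.
Qed.

Lemma irrep_annihilator (p : irrep) (x : A) (v : irrep_space p) :
  (forall a, p (x * a) v = 0) -> v <> 0 -> rep_kernel p x.
Proof.
move=> xv0 v0.
pose K := [set w | forall a, p (x * a) w = 0].
have [||K0|KT] := (irrep_irr p).2 K.
- split=> [a|z u w Ku Kw a|a w Kw b]; first exact: rep0r.
  + by rewrite rep_linear Ku Kw scaler0 addr0.
  + by rewrite -repM -mulrA Kw.
- rewrite [K](_ : _ = \bigcap_(a in setT) [set w | p (x * a) w = 0]).
    by apply: closed_bigI => a _; apply: closed_rep_ker.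
  by apply/seteqP; split=> w Kw a; [move=> _|]; apply: Kw.
- by have : K v by []; rewrite K0.
- by move=> w; have : K w by [rewrite KT]; move=> /(_ 1); rewrite mulr1.
Qed.

Lemma primitive_prime (P : Prim) (x y : A) :
  (forall a, sval P (x * a * y)) -> sval P x \/ sval P y.
Proof.
case: P => I [p] /= -> xy.
have [|/existsNP[v yv]] := pselect (rep_kernel p y); first by right.
left; apply: (@irrep_annihilator p x (p y v)) => // a.
by rewrite -repM xy.
Qed.

Lemma primitive_ideal (P : Prim) (x y z : A) :
  sval P y -> sval P (x * y * z).
Proof. by case: P => I [p] /= -> yP v; rewrite !repM yP rep0r. Qed.

Lemma jacobson_openT : jacobson_open setT.
Proof.
apply/jacobson_openP; rewrite setCT => -[I [p Ip]] h.
have [[x [v xv]] _] := irrep_irr p.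
have : I x by apply: h => Q [].
by rewrite [I in I x]Ip => /(_ v)/xv.
Qed.

Lemma jacobson_openI : setI_closed jacobson_open.
Proof.
move=> U V /jacobson_openP oU /jacobson_openP oV.
apply/jacobson_openP => P hP [UP VP].
have /existsNP[x /not_implyP[xU xP]] : ~ hull_kernel (~` U) P.
  by move/oU; apply.
have /existsNP[y /not_implyP[yV yP]] : ~ hull_kernel (~` V) P.
  by move/oV; apply.
suff: sval P x \/ sval P y by case.
apply: primitive_prime => a.
apply: hP => Q /not_andP[UQ|VQ].
  by rewrite -[x]mul1r -mulrA; apply: primitive_ideal; apply: xU.
by rewrite -[_ * y]mulr1; apply: primitive_ideal; apply: yV.
Qed.

Lemma jacobson_open_bigU (I : Type) (f : I -> set Prim) :
  (forall i, jacobson_open (f i)) -> jacobson_open (\bigcup_i f i).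
Proof.
move=> of_; apply/jacobson_openP => P hP [i _ fiP].
have /jacobson_openP := of_ i; apply; last exact: fiP.
by apply: hull_kernelS hP => Q + fiQ; apply; exists i.
Qed.

HB.instance Definition _ := isOpenTopological.Build Prim
  jacobson_openT jacobson_openI jacobson_open_bigU.

Lemma unitary_equiv_kernel H1 H2 (rho1 : representation H1)
    (rho2 : representation H2) :
  unitary_equiv rho1 rho2 -> rep_kernel rho1 = rep_kernel rho2.
Proof.
have half H H' (r : representation H) (r' : representation H') :
    unitary_equiv r r' -> rep_kernel r `<=` rep_kernel r'.
  move=> [U [Ulin Usurj _ Urep]] x rx0 w.
  have [v <-] := Usurj w; rewrite -Urep rx0.
  by have := Ulin (-1) 0 0; rewrite scaleN1r addNr scaleN1r addNr.
by move=> e; apply/seteqP; split; apply: half => //; apply: unitary_equiv_sym.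
Qed.

(* The topology pulled back from [Prim] along the map [pi] |-> ker pi. *)
Definition spectrum_open (U : spectrum -> Prop) : Prop :=
  exists2 V : set Prim, open V &
    forall p : irrep, U (irrep_class p) <-> V (prim_of_irrep p).

End Representations.

(* C^n with its standard inner product. An alias is needed because the library
   puts the sup norm on matrices. *)
Definition Cn (R : realType) (n : nat) : Type := 'cV[R[i]]_n.

HB.instance Definition _ (R : realType) n := GRing.Lmodule.on (Cn R n).

Section EuclideanSpace.
Variables (R : realType) (n : nat).
Local Notation V := (Cn R n).

Definition Cn_inner (u v : V) : R[i] := \sum_(i < n) u i 0 * (v i 0)^*.

Lemma Cn_inner_bilinear :
  bilinear_for *%R (Num.conj \; *%R) Cn_inner.
Proof.
split=> [v a u w|u a v w] /=; rewrite /Cn_inner mulr_sumr -big_split /=.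
  by apply: eq_bigr => i _; rewrite !mxE mulrDl mulrA.
by apply: eq_bigr => i _; rewrite !mxE rmorphD rmorphM mulrDr mulrCA.
Qed.

HB.instance Definition _ := bilinear_isBilinear.Build R[i] V V R[i]
  *%R (Num.conj \; *%R) Cn_inner Cn_inner_bilinear.

Lemma Cn_inner_hermitian (u v : V) :
  Cn_inner u v = (-1) ^+ false * (Cn_inner v u)^*.
Proof.
rewrite mul1r /Cn_inner rmorph_sum; apply: eq_bigr => i _.
by rewrite rmorphM /= conjCK mulrC.
Qed.

HB.instance Definition _ := isHermitianSesquilinear.Build R[i] V
  false Num.conj Cn_inner Cn_inner_hermitian.

Lemma Cn_inner_gt0 (u : V) : u != 0 -> 0 < Cn_inner u u.
Proof.
move=> u0; rewrite lt_def; apply/andP; split; last first.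
  by apply: sumr_ge0 => i _; rewrite -normCK exprn_ge0.
apply: contra u0; rewrite psumr_eq0 => [/allP u0|i _]; last first.
  by rewrite -normCK exprn_ge0.
apply/eqP/matrixP => i j; rewrite ord1 mxE; apply/eqP.
by have := u0 i (mem_index_enum _); rewrite -normCK sqrf_eq0 normr_eq0.
Qed.

HB.instance Definition _ := isDotProduct.Build R[i] V Cn_inner Cn_inner_gt0.

Definition Cn_norm (v : V) : R[i] := sqrtC (Cn_inner v v).

Lemma Cn_normD (u v : V) : Cn_norm (u + v) <= Cn_norm u + Cn_norm v.
Proof.
exact: (triangle_lerif (@Cn_inner : {dot 'cV[R[i]]_n for Num.conj})).
Qed.

Lemma Cn_normZ (z : R[i]) (v : V) : Cn_norm (z *: v) = `|z| * Cn_norm v.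
Proof.
by rewrite /Cn_norm dnormZ sqrtCM ?nnegrE ?exprn_ge0// sqrCK.
Qed.

Lemma Cn_norm0_eq0 (v : V) : Cn_norm v = 0 -> v = 0.
Proof. by move/eqP; rewrite sqrtC_eq0 dnorm_eq0 => /eqP. Qed.

HB.instance Definition _ :=
  Lmodule_isNormed.Build R[i] V Cn_normD Cn_normZ Cn_norm0_eq0.

Lemma sqr_Cn_normE (v : V) : `|v| ^+ 2 = Cn_inner v v.
Proof. by rewrite [`|v|]/(Cn_norm v) sqrtCK. Qed.

Lemma Cn_coord_le (v : V) i : `|v i 0| <= `|v|.
Proof.
rewrite -ler_sqr ?nnegrE// sqr_Cn_normE /Cn_inner (bigD1 i)//= -normCK lerDl.
by apply: sumr_ge0 => j _; rewrite -normCK exprn_ge0.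
Qed.

Lemma Cn_norm_le (v : V) : `|v| <= \sum_(i < n) `|v i 0|.
Proof.
have norm_delta (i : 'I_n) : `|delta_mx i 0 : V| = 1.
  rewrite [LHS]/(Cn_norm _) /Cn_norm /Cn_inner (bigD1 i)//= big1 => [|j ji].
    by rewrite !mxE !eqxx /= conjC1 mulr1 addr0 sqrtC1.
  by rewrite !mxE (negPf ji) /= mul0r.
rewrite {1}[v](_ : v = \sum_i v i 0 *: (delta_mx i 0 : V)).
  apply: le_trans (ler_norm_sum _ _ _) _; apply: ler_sum => i _.
  by rewrite normrZ norm_delta mulr1.
by rewrite [LHS]matrix_sum_delta; apply: eq_bigr => i _; rewrite big_ord1.
Qed.

Lemma Cn_lipschitz_cvg (F : set_system V) (f : V -> R) :
  ProperFilter F -> cauchy F -> (forall u v, `|f u - f v|%:C <= `|u - v|) ->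
  cvg (f @ F).
Proof.
move=> FF /cauchyP Fc fL; apply/cauchy_cvgP/cauchyP => e e0.
have [|w wF] := Fc e%:C; first by rewrite ltcR.
exists (f w); rewrite /= nbhs_simpl.
apply: filterS wF => v; rewrite -!ball_normE /= => wv.
by rewrite -ltcR (le_lt_trans _ wv).
Qed.

Let normc_ge_Im (z : R[i]) : `|complex.Im z|%:C <= `|z|.
Proof.
by rewrite normc_def lecR -sqrtr_sqr ler_wsqrtr// lerDr sqr_ge0.
Qed.

Let normc_le (z : R[i]) : `|z| <= (`|complex.Re z| + `|complex.Im z|)%:C.
Proof.
rewrite normc_def lecR -ler_sqr ?nnegrE ?addr_ge0// sqr_sqrtr; last first.
  by rewrite addr_ge0 ?sqr_ge0.
by rewrite sqrrD !real_normK ?num_real// addrAC lerDl mulrn_wge0 ?mulr_ge0.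
Qed.

Lemma Cn_complete (F : set_system V) : ProperFilter F -> cauchy F -> cvg F.
Proof.
move=> FF Fc.
have ReL i (u v : V) :
    `|complex.Re (u i 0) - complex.Re (v i 0)|%:C <= `|u - v|.
  have := Cn_coord_le (u - v) i; rewrite !mxE -raddfB.
  exact: le_trans (normc_ge_Re _).
have ImL i (u v : V) :
    `|complex.Im (u i 0) - complex.Im (v i 0)|%:C <= `|u - v|.
  have := Cn_coord_le (u - v) i; rewrite !mxE -raddfB.
  exact: le_trans (normc_ge_Im _).
have cRe i := Cn_lipschitz_cvg FF Fc (ReL i).
have cIm i := Cn_lipschitz_cvg FF Fc (ImL i).
pose l : V := \col_i (lim ((fun v : V => complex.Re (v i 0)) @ F) +i*
                      lim ((fun v : V => complex.Im (v i 0)) @ F)).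
apply/cvg_ex; exists l; apply/fcvgrPdist_lt => e e0.
have eR : e = (complex.Re e)%:C by rewrite RRe_real// gtr0_real.
pose d : R := complex.Re e / (n.+1)%:R / 2.
have d0 : 0 < d by rewrite !divr_gt0 ?ltr0n// -ltcR -eR.
near=> v.
have lv i : `|(l - v) i 0| <= (d + d)%:C.
  rewrite (le_trans (normc_le _))// lecR !mxE !raddfB /= lerD// ltW//.
    move: i; near: v; apply: filter_forall => i.
    by have /cvgrPdist_lt/(_ d d0) := cRe i.
  move: i; near: v; apply: filter_forall => i.
    by have /cvgrPdist_lt/(_ d d0) := cIm i.
apply: (le_lt_trans (Cn_norm_le _)).
apply: (le_lt_trans (ler_sum _ (fun i _ => lv i))).
rewrite sumr_const card_ord -rmorphMn /= eR ltcR -splitr.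
rewrite -mulr_natr mulrAC ltr_pdivrMr ?ltr0n// ltr_pM2l ?ltr_nat//.
by rewrite -ltcR -eR.
Unshelve. all: by end_near. Qed.

HB.instance Definition _ := Uniform_isComplete.Build V Cn_complete.

HB.instance Definition _ := isHilbert.Build R V sqr_Cn_normE.

End EuclideanSpace.

Section SU2.
Variable R : realType.

Definition SU2 : set (R[i] * R[i]) :=
  [set p | `|p.1| ^+ 2 + `|p.2| ^+ 2 = 1].

Definition SU2_sim_op (p q : SU2) : bool :=
  let: (a, c) := val p in
  if (a == 0) || (c == 0) then val q == (a, c)
  else val q \in [:: (a, c); (- a, c); (a, - c); (- a, - c)].

Lemma SU2_sim_refl : reflexive SU2_sim_op.
Proof.
move=> p; rewrite /SU2_sim_op; case: (val p) => a c.
by case: ifP; rewrite ?inE eqxx.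
Qed.

Lemma SU2_sim_sym : symmetric SU2_sim_op.
Proof.
have half p q : SU2_sim_op p q -> SU2_sim_op q p.
  rewrite /SU2_sim_op; case: (val p) => a c; case: (val q) => b d.
  case: ifPn => [ac /eqP[-> ->]|]; first by rewrite ac.
  rewrite negb_or => /andP[a0 c0]; rewrite !inE.
  by case/or4P => /eqP[-> ->]; rewrite ?oppr_eq0 (negPf a0) (negPf c0)
    ?opprK !eqxx ?orbT.
by move=> p q; apply/idP/idP; apply: half.
Qed.

Lemma SU2_sim_trans : transitive SU2_sim_op.
Proof.
move=> q p r; rewrite /SU2_sim_op.
case: (val p) => a c; case: (val q) => b d; case: (val r) => e f.
case: ifPn => [ac /eqP[-> ->]|]; first by rewrite ac.
rewrite negb_or => /andP[a0 c0]; rewrite !inE.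
by case/or4P => /eqP[-> ->]; rewrite ?oppr_eq0 (negPf a0) (negPf c0)
  ?opprK => /or4P[] /eqP[-> ->]; rewrite !eqxx ?orbT.
Qed.

Definition SU2_sim := EquivRel _ SU2_sim_refl SU2_sim_sym SU2_sim_trans.

Definition SU2_quot := quotient_topology {eq_quot SU2_sim}.

(* The dimension and the images of alpha and gamma under pi_(a, c). *)
Definition pi_mx (p : SU2) : {n : nat & ('M[R[i]]_n * 'M[R[i]]_n)%type} :=
  let: (a, c) := val p in
  if c == 0 then existT _ 1%N (a%:M, 0)
  else if a == 0 then existT _ 1%N (0, c%:M)
  else existT _ 2%N
    (\matrix_(i, j) (if i == j then if i == 0 then a else - a else 0),
     \matrix_(i, j) (if i == j then 0 else c)).

Definition pi_dim (p : SU2) : nat := tag (pi_mx p).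
Definition pi_alpha (p : SU2) : 'M[R[i]]_(pi_dim p) := (tagged (pi_mx p)).1.
Definition pi_gamma (p : SU2) : 'M[R[i]]_(pi_dim p) := (tagged (pi_mx p)).2.

Variables (A : cstarAlgType R) (alpha gamma : A).

(* These conditions determine [rho]: it is the representation that the universal
   property of A attaches to the pair of matrices. *)
Definition is_pi (p : SU2) (rho : representation A (Cn R (pi_dim p))) : Prop :=
  [/\ forall v, rho 1 v = v,
      forall v, rho alpha v = pi_alpha p *m v &
      forall v, rho gamma v = pi_gamma p *m v].

Definition homeomorphism_onto_spectrum (Pi : SU2_quot -> spectrum A) : Prop :=
  bijective Pi /\ forall U : spectrum A -> Prop,
    open [set x | U (Pi x)] <-> spectrum_open U.

End SU2.

Arguments SU2 : clear implicits.

(* Main.v *)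
Require Import Defs.
From HB Require Import structures.
From mathcomp Require Import all_boot all_order all_algebra.
From mathcomp Require Import all_classical all_reals all_analysis.
From mathcomp Require Import complex.
From mathcomp Require Import ring lra.
Import Order.TTheory GRing.Theory Num.Theory.
Import numFieldNormedType.Exports.

(** Why the theorem holds.  In C(SU_{-1}(2)) the elements alpha^2, gamma^2 and
    their adjoints are central, because alpha and gamma are normal and
    anticommute with each other and with each other's adjoints.  Schur's lemma
    turns alpha^2 and gamma^2 into scalars a^2 and c^2 in every irreducible
    representation.  If a c <> 0, then gamma exchanges the eigenspaces of alpha
    for a and -a, and one eigenvector e0 together with gamma e0 spans an
    invariant plane on which alpha and gamma act by the matrices of pi_(a,c);
    if a c = 0, a common eigenvector spans an invariant line.  Irreducibility
    leaves no room for anything else ([irrep_classification]).  The kernel of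
    pi_(a,c) remembers a^2 and c^2, and even a and c when a c = 0
    ([pi_kernel_sim]), so classes of irreducible representations, primitive
    ideals and points of X are the same thing.

    The comparison of topologies has two halves.

    - Jacobson closed sets pull back to closed sets.  The two matrices that
      define pi_(a,c) for a c <> 0 define a representation T_(a,c) on C^2 for
      every point of SU(2), and each entry of T_(a,c) x is continuous in (a,c).
      At the degenerate points T_(a,c) is a sum of two characters, one of which
      is pi_(a,c).  So the zero set of (a,c) |-> pi_(a,c) x is the union of three
      closed pieces: T x = 0, and the zeros of the relevant character on each
      of the two degenerate circles ([closed_kernel]).

    - Open saturated sets O come from Jacobson open sets.  Given q = (b,d) in O,
      some x must vanish in pi_p for all p outside O but not in pi_q
      ([separation]).  The central element |alpha^2 - b^2|^2 + |gamma^2 - d^2|^2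
      acts by a scalar that is small at (a,c) only if some (+-a, +-c) is near q.
      The positive part of e minus this element is the required x when b d <> 0.
      If b d = 0 it fails to distinguish q from -q, which is not equivalent to
      q; a second factor, the positive part of e' - |alpha - b|^2 - |gamma - d|^2,
      settles this: at the characters, the only places where it matters, it is
      a scalar too.

    The C*-algebraic input is reduced to one construction: for self-adjoint z of
    norm at most 1, a square root of 1 - z that commutes with all that commutes
    with z ([cstar_sqrt1B]).  It yields |x| in the form t^2 with t^4 = x^2
    ([cstar_fourth_root]), the contractivity of representations, Schur's lemma
    and the positive parts above.  The universal property is used twice: maps
    into matrix algebras give the representations, and maps into closed
    star-subalgebras show that alpha and gamma generate a dense subalgebra
    ([C_SUm1_2_ind]). *)

Set Implicit Arguments.
Unset Strict Implicit.
Unset Printing Implicit Defensive.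

Local Open Scope quotient_scope.
Local Open Scope classical_set_scope.
Local Open Scope complex_scope.
Local Open Scope ring_scope.



(** * The norm and the involution of an abstract algebra *)

Section CStarNorm.
Variables (R : realType) (A : cstarAlgType R).
Implicit Types (x y z : A) (r : R).

(** The real number behind the value of [cnorm], which lies in R[i]. *)
Definition rnorm x : R := complex.Re (cnorm x).

Lemma cnormN x : cnorm (- x) = cnorm x.
Proof. by rewrite -scaleN1r cnormZ normrN1 mul1r. Qed.

Lemma cnorm_ge0 x : 0 <= cnorm x.
Proof.
have := cnormD x (- x); rewrite subrr cnormN.
rewrite -{1}(scale0r (0 : A)) cnormZ normr0 mul0r -mulr2n.
by rewrite pmulrn_lge0.
Qed.

Lemma cnormE x : cnorm x = (rnorm x)%:C.
Proof. by rewrite /rnorm RRe_real// ger0_real// cnorm_ge0. Qed.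

Lemma rnorm_ge0 x : 0 <= rnorm x.
Proof. by rewrite -lecR -cnormE cnorm_ge0. Qed.

Lemma rnormD x y : rnorm (x + y) <= rnorm x + rnorm y.
Proof. by rewrite -lecR rmorphD /= -!cnormE cnormD. Qed.

Lemma rnormN x : rnorm (- x) = rnorm x.
Proof. by rewrite /rnorm cnormN. Qed.

Lemma rnormM x y : rnorm (x * y) <= rnorm x * rnorm y.
Proof. by rewrite -lecR rmorphM /= -!cnormE cnormM. Qed.

Lemma rnormZ r x : rnorm (r%:C *: x) = `|r| * rnorm x.
Proof.
apply: complexI; rewrite rmorphM /= -!cnormE cnormZ normc_def /=.
by rewrite expr0n /= addr0 sqrtr_sqr.
Qed.

Lemma rnorm0 : rnorm 0 = 0.
Proof. by rewrite -(scale0r 0) -[0 : R[i]]/(0%:C) rnormZ normr0 mul0r. Qed.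

Lemma rnorm0_eq0 x : rnorm x = 0 -> x = 0.
Proof. by move=> x0; apply: cnorm_eq0; rewrite cnormE x0. Qed.

Lemma rnorm_le_eq x y : (forall e, 0 < e -> rnorm (x - y) <= e) -> x = y.
Proof.
move=> xy; apply/eqP; rewrite -subr_eq0; apply/eqP/rnorm0_eq0.
by apply/eqP; rewrite eq_le rnorm_ge0 andbT; apply/ler_addgt0Pl => e /xy; rewrite addr0.
Qed.

Lemma rnorm_cstar x : rnorm (star x * x) = rnorm x ^+ 2.
Proof. by apply: complexI; rewrite -cnormE cstar_identity cnormE rmorphXn. Qed.

Lemma star0 : star 0 = 0 :> A.
Proof. by apply: (addIr (star 0)); rewrite -starD addr0 add0r. Qed.

Lemma starN x : star (- x) = - star x.
Proof. by apply/eqP; rewrite -addr_eq0 -starD addNr star0. Qed.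

Lemma starB x y : star (x - y) = star x - star y.
Proof. by rewrite starD starN. Qed.

Lemma star1 : star 1 = 1 :> A.
Proof. by rewrite -[LHS]mulr1 -[X in _ * X]starK -starM mulr1 starK. Qed.

Lemma starZr r x : star (r%:C *: x) = r%:C *: star x.
Proof. by rewrite starZ; congr (_ *: _); exact: conjc_real. Qed.

Lemma rnorm_star x : rnorm (star x) = rnorm x.
Proof.
have le y : rnorm y <= rnorm (star y).
  have [->|y0] := eqVneq (rnorm y) 0; first exact: rnorm_ge0.
  rewrite -(ler_pM2r (_ : 0 < rnorm y)) ?lt_def ?y0 ?rnorm_ge0//.
  by rewrite -expr2 -rnorm_cstar rnormM.
by apply/eqP; rewrite eq_le le -{2}(starK x) le.
Qed.

Lemma rnorm1 : rnorm 1 = 1.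
Proof.
have := rnorm_cstar 1; rewrite star1 mulr1 expr2 => /esym/eqP.
rewrite -subr_eq0 -{3}[rnorm 1]mulr1 -mulrBr mulf_eq0 => /orP[/eqP/rnorm0_eq0/eqP|].
  by rewrite oner_eq0.
by rewrite subr_eq0 => /eqP.
Qed.

Lemma rnorm_complete (u : nat -> A) :
  (forall e, 0 < e -> exists N, forall m n,
     (N <= m)%N -> (N <= n)%N -> rnorm (u m - u n) < e) ->
  exists l, forall e, 0 < e -> exists N, forall n,
     (N <= n)%N -> rnorm (u n - l) < e.
Proof.
move=> uC; have [|l ul] := @cnorm_complete R A u.
  move=> e e0; have eR : e = (complex.Re e)%:C by rewrite RRe_real// gtr0_real.
  have [|N uN] := uC (complex.Re e); first by rewrite -ltcR -eR.
  by exists N => m n Nm Nn; rewrite eR cnormE ltcR uN.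
exists l => e e0; have [|N uN] := ul e%:C; first by rewrite ltcR.
by exists N => n Nn; rewrite -ltcR -cnormE uN.
Qed.

(** Completeness in the form in which it is used: a rate replaces the two-sided
    Cauchy condition. *)
Lemma rnorm_complete_rate (u : nat -> A) (d : nat -> R) :
  (forall m n, (n <= m)%N -> rnorm (u m - u n) <= d n) ->
  (forall e, 0 < e -> exists n, d n < e) ->
  exists l, forall e, 0 < e -> exists N, forall n,
     (N <= n)%N -> rnorm (u n - l) < e.
Proof.
move=> ud d0; apply: rnorm_complete => e e0.
have [|N dN] := d0 (e / 2); first by rewrite divr_gt0.
exists N => m n Nm Nn; rewrite [e]splitr.
rewrite -(subrK (u N) (u m)) -addrA (le_lt_trans (rnormD _ _))//.
apply: ltrD; first exact: le_lt_trans (ud _ _ Nm) _.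
by rewrite -rnormN opprB; exact: le_lt_trans (ud _ _ Nn) _.
Qed.

Lemma rnorm_le_eqC (C : R) x y : (forall e, 0 < e -> rnorm (x - y) <= C * e) -> x = y.
Proof.
move=> xy; apply: rnorm_le_eq => e e0.
have C1 : 0 < `|C| + 1 by rewrite ltr_wpDl.
apply: le_trans (xy (e / (`|C| + 1)) (divr_gt0 e0 C1)) _.
rewrite mulrCA ger_pMr// ler_pdivrMr// mul1r.
by rewrite (le_trans (ler_norm C))// lerDl.
Qed.

End CStarNorm.

(** * Square roots and absolute values *)

Lemma half_double (R : realType) (V : lmodType R[i]) (x : V) :
  (2^-1)%:C *: (x + x) = x.
Proof.
rewrite scalerDr -scalerDl -rmorphD /= -[X in X + X]mul1r -splitr.
exact: scale1r.
Qed.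

Section SquareRoot.
Variables (R : realType) (A : cstarAlgType R).
Implicit Types (x y z w : A) (r : R).

Let half : R[i] := (2^-1)%:C.

(** Writing the root of 1 - z as 1 - y turns the equation into y = (z + y^2) / 2,
    which is solved by iteration from 0.  The same iteration with z = 1 in the
    reals majorizes it, because only nonnegative coefficients occur. *)
Let sqrt_seq z n : A := iter n (fun y => half *: (z + y * y)) 0.
Let sqrt_bound n : R := iter n (fun r => (1 + r * r) / 2) 0.

Let sqrt_bound01 n : 0 <= sqrt_bound n <= 1.
Proof.
elim: n => [|n /andP[r0 r1]] /=; first by rewrite lexx ler01.
rewrite -/(sqrt_bound n); move: (sqrt_bound n) r0 r1 => r r0 r1.
by apply/andP; split; nra.
Qed.

(** The defect d = 1 - r evolves by d |-> d - d^2 / 2, which increases on [0, 1],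
    and maps 2 / k below 2 / (k + 1). *)
Let sqrt_bound_rate n : 1 - sqrt_bound n <= 2 / n.+2%:R.
Proof.
elim: n => [|n IH] /=; first by rewrite subr0 divff.
have /andP[r0 r1] := sqrt_bound01 n.
rewrite -/(sqrt_bound n); move: (sqrt_bound n) r0 r1 IH => r r0 r1 IH.
have -> : n.+3%:R = n.+2%:R + 1 :> R by rewrite -natr1.
have : 2 <= n.+2%:R :> R by rewrite ler_nat.
move: (n.+2%:R) IH => k IH k2.
have k0 : 0 < k by apply: lt_le_trans k2.
pose q := 2 / k; have qk : q * k = 2 by rewrite mulfVK ?gt_eqF.
rewrite -/q in IH; rewrite ler_pdivlMr ?ltr_wpDl// ?ltW//.
have q0 : 0 < q by rewrite divr_gt0.
have q1 : q <= 1 by rewrite ler_pdivrMr// mul1r.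
have mono : 0 <= (q - (1 - r)) * (1 - (q + (1 - r)) / 2).
  by apply: mulr_ge0; lra.
have : 0 <= (q - (1 - r)) * (1 - (q + (1 - r)) / 2) * (k + 1).
  by apply: mulr_ge0 => //; lra.
have -> : (q - (1 - r)) * (1 - (q + (1 - r)) / 2) * (k + 1) =
  q * k + q - (q * q + (q * k) * q) / 2 - (1 - (1 + r * r) / 2) * (k + 1).
  by field.
by rewrite qk; nra.
Qed.

(** The identity u^2 - v^2 = u (u - v) + (u - v) v needs no commutation. *)
Let sqrt_seqB z m n : sqrt_seq z m.+1 - sqrt_seq z n.+1 =
  half *: (sqrt_seq z m * (sqrt_seq z m - sqrt_seq z n) +
           (sqrt_seq z m - sqrt_seq z n) * sqrt_seq z n).
Proof.
rewrite /= -/(sqrt_seq z m) -/(sqrt_seq z n) -scalerBr; congr (_ *: _).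
by rewrite mulrBr mulrBl addrA subrK opprD addrACA subrr add0r.
Qed.

Let rnorm_half z : rnorm (half *: z) = rnorm z / 2.
Proof. by rewrite rnormZ ger0_norm ?invr_ge0// mulrC. Qed.

Let sqrt_seq_le z n : rnorm z <= 1 -> rnorm (sqrt_seq z n) <= sqrt_bound n.
Proof.
move=> z1; elim: n => [|n IH] /=; first by rewrite rnorm0.
rewrite rnorm_half ler_pM2r ?invr_gt0// (le_trans (rnormD _ _))// lerD//.
by rewrite (le_trans (rnormM _ _))// ler_pM ?rnorm_ge0.
Qed.

Let sqrt_seq_step z n : rnorm z <= 1 ->
  rnorm (sqrt_seq z n.+1 - sqrt_seq z n) <= sqrt_bound n.+1 - sqrt_bound n.
Proof.
move=> z1; elim: n => [|n IH].
  rewrite !subr0 (le_trans (sqrt_seq_le _ z1))//.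
rewrite sqrt_seqB rnorm_half ler_pdivrMr// (le_trans (rnormD _ _))//.
have -> : (sqrt_bound n.+2 - sqrt_bound n.+1) * 2 =
    sqrt_bound n.+1 * (sqrt_bound n.+1 - sqrt_bound n) +
    (sqrt_bound n.+1 - sqrt_bound n) * sqrt_bound n.
  by rewrite [sqrt_bound n.+2]/= -/(sqrt_bound n.+1) [in LHS]/=
    -/(sqrt_bound n) /=; field.
by rewrite lerD// (le_trans (rnormM _ _))// ler_pM ?rnorm_ge0// sqrt_seq_le.
Qed.

Let sqrt_seq_cauchy z m n : rnorm z <= 1 -> (n <= m)%N ->
  rnorm (sqrt_seq z m - sqrt_seq z n) <= 2 / n.+2%:R.
Proof.
move=> z1 le_nm; apply: le_trans (sqrt_bound_rate n).
apply: (@le_trans _ _ (sqrt_bound m - sqrt_bound n)); last first.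
  by rewrite lerB//; case/andP: (sqrt_bound01 m).
rewrite -(subnK le_nm); elim: (m - n)%N => [|k IH].
  by rewrite add0n !subrr rnorm0.
rewrite addSn -(subrK (sqrt_seq z (k + n)) (sqrt_seq z _.+1)) -addrA.
rewrite (le_trans (rnormD _ _))// (le_trans (lerD (sqrt_seq_step _ z1) IH))//.
by rewrite addrA subrK.
Qed.

(** As y is a limit of polynomials in z without constant term, it inherits
    self-adjointness and the commutant of z. *)
Lemma cstar_sqrt1B z : star z = z -> rnorm z <= 1 ->
  exists y, [/\ star y = y, rnorm y <= 1, (1 - y) * (1 - y) = 1 - z &
                forall w, w * z = z * w -> w * y = y * w].
Proof.
move=> zs z1.
have [|e e0|l ul] := @rnorm_complete_rate R A (sqrt_seq z) (fun n => 2 / n.+2%:R).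
- by move=> m n; apply: sqrt_seq_cauchy.
- have [n ne] : exists n, 2 / e < n%:R.
    by exists (Num.truncn (2 / e)).+1; rewrite truncnS_gt.
  exists n; rewrite ltr_pdivrMr// mulrC -ltr_pdivrMr// (lt_le_trans ne)//.
  by rewrite ler_nat -addn2 leq_addr.
have {}ul e : 0 < e -> exists n,
    rnorm (sqrt_seq z n - l) < e /\ rnorm (sqrt_seq z n.+1 - l) < e.
  by move=> /ul[n un]; exists n; split; apply: un.
have u1 n : rnorm (sqrt_seq z n) <= 1.
  by rewrite (le_trans (sqrt_seq_le _ z1))//; case/andP: (sqrt_bound01 n).
have us n : star (sqrt_seq z n) = sqrt_seq z n.
  elim: n => [|n IH] /=; first exact: star0.
  by rewrite starZr starD starM IH zs.
have uC w n : w * z = z * w -> w * sqrt_seq z n = sqrt_seq z n * w.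
  move=> wz; elim: n => [|n IH] /=; first by rewrite mulr0 mul0r.
  by rewrite -scalerAr -scalerAl mulrDr mulrDl wz mulrA IH -!mulrA IH.
have l1 : rnorm l <= 1.
  apply/ler_addgt0Pl => e /ul[n [un _]].
  rewrite -(subrK (sqrt_seq z n) l) (le_trans (rnormD _ _))// lerD// -rnormN opprB.
  exact: ltW.
exists l; split=> // [||w wz].
- apply: (@rnorm_le_eqC _ _ 2) => e /ul[n [/ltW un _]].
  rewrite -(subrK (sqrt_seq z n) (star l)) -addrA (le_trans (rnormD _ _))//.
  by rewrite mulr_natl mulr2n lerD// -us -starB rnorm_star -rnormN opprB.
- suff -> : z = l + l - l * l.
    by rewrite mulrBr mulr1 mulrBl mul1r !opprD !opprK !addrA.
  suff lE : l = half *: (z + l * l).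
    have -> : l + l = z + l * l; last by rewrite addrK.
    by rewrite {1 2}lE -scalerDr half_double.
  apply: (@rnorm_le_eqC _ _ 2) => e /ul[n [/ltW un /ltW un1]].
  rewrite -(subrK (sqrt_seq z n.+1) l) -addrA (le_trans (rnormD _ _))//.
  rewrite mulr_natl mulr2n lerD//; first by rewrite -rnormN opprB.
  rewrite (subrK (sqrt_seq z n.+1) l) /= -/(sqrt_seq z n) -scalerBr.
  rewrite opprD addrACA subrr add0r rnorm_half ler_pdivrMr//.
  have -> : sqrt_seq z n * sqrt_seq z n - l * l =
      sqrt_seq z n * (sqrt_seq z n - l) + (sqrt_seq z n - l) * l.
    by rewrite mulrBr mulrBl addrA subrK.
  rewrite (le_trans (rnormD _ _))// mulr_natr mulr2n.
  rewrite lerD// (le_trans (rnormM _ _))//.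
    by rewrite -[e]mul1r ler_pM ?rnorm_ge0.
  by rewrite -[e]mulr1 ler_pM ?rnorm_ge0.
- apply: (@rnorm_le_eqC _ _ (rnorm w * 2)) => e /ul[n [/ltW un _]].
  rewrite -[w * l](subrK (w * sqrt_seq z n)) -addrA (le_trans (rnormD _ _))//.
  rewrite [in X in _ + X](uC _ _ wz) -mulrBr -mulrBl.
  rewrite [leRHS](_ : _ = rnorm w * e + e * rnorm w); last by ring.
  rewrite lerD// (le_trans (rnormM _ _))//.
    by rewrite ler_wpM2l ?rnorm_ge0// -rnormN opprB.
  by rewrite ler_wpM2r ?rnorm_ge0.
Qed.

(** This is where positivity of squares enters: if b is the root of 1 - x^2, then
    b + i x is unitary, so its real part b has norm at most 1. *)
Lemma rnorm_1Bsqr_le1 x : star x = x -> rnorm x <= 1 -> rnorm (1 - x * x) <= 1.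
Proof.
move=> xs x1.
have [||y [ys _ yE yC]] := @cstar_sqrt1B (x * x).
- by rewrite starM xs.
- by rewrite (le_trans (rnormM _ _))// -[1]mulr1 ler_pM ?rnorm_ge0.
rewrite -yE; set b := 1 - y in yE *.
have bs : star b = b by rewrite starB star1 ys.
have xb : x * b = b * x by rewrite mulrBr mulrBl mulr1 mul1r yC// mulrA.
clearbody b.
pose u := b + 'i *: x.
have su : star u = b - 'i *: x.
  by rewrite starD bs starZ xs conjCi scaleNr.
have uu : star u * u = 1.
  rewrite su mulrDr !mulrBl -!scalerAl -!scalerAr xb scalerA -(expr2 'i) sqrCi.
  rewrite scaleN1r opprK.
  by rewrite addrA subrK yE subrK.
have u1 : rnorm u = 1.
  apply/eqP; rewrite -[_ == _](@eqrXn2 _ 2)// ?rnorm_ge0//.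
  by rewrite -rnorm_cstar uu rnorm1 expr1n.
have b1 : rnorm b <= 1.
  have -> : b = half *: (u + star u).
    by rewrite su addrACA subrr addr0 half_double.
  rewrite rnorm_half ler_pdivrMr// mul1r (le_trans (rnormD _ _))//.
  by rewrite rnorm_star u1.
by rewrite (le_trans (rnormM _ _))// -[1]mulr1 ler_pM ?rnorm_ge0.
Qed.

(** Two square roots in a row: [t * t] is the absolute value of x, and being the
    square of a self-adjoint element it acts positively in every representation.
    The bound [rnorm_1Bsqr_le1] makes x^2 = 1 - (1 - x^2) accessible to
    [cstar_sqrt1B] even though x^2 may fail to be invertible. *)
Lemma cstar_fourth_root x : star x = x ->
  exists t, [/\ star t = t, (t * t) * (t * t) = x * x &
                forall w, w * x = x * w -> w * t = t * w].
Proof.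
move=> xs.
have ZZ (k l : R[i]) (v w : A) : (k *: v) * (l *: w) = (k * l) *: (v * w).
  by rewrite -scalerAl -scalerAr scalerA.
wlog x1 : x xs / rnorm x <= 1 => [unit|].
  have [->|x0] := eqVneq x 0; first by apply: unit; rewrite ?star0 ?rnorm0.
  have k0 : 0 < rnorm x.
    by rewrite lt_def rnorm_ge0 andbT; apply: contra x0 => /eqP/rnorm0_eq0->.
  have [||t [ts tE tC]] := unit ((rnorm x)^-1%:C *: x).
  - by rewrite starZr xs.
  - by rewrite rnormZ gtr0_norm ?invr_gt0// mulVf// gt_eqF.
  exists ((Num.sqrt (rnorm x))%:C *: t); split.
  - by rewrite starZr ts.
  - rewrite !ZZ tE ZZ scalerA -!rmorphM /= [X in X%:C](_ : _ = 1) ?scale1r//.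
    by rewrite -!expr2 sqr_sqrtr ?rnorm_ge0//; field; rewrite gt_eqF.
  - move=> w wx; rewrite -scalerAr -scalerAl tC//.
    by rewrite -scalerAr -scalerAl wx.
have [||y [ys y1 yE yC]] := @cstar_sqrt1B (1 - x * x).
- by rewrite starB star1 starM xs.
- exact: rnorm_1Bsqr_le1.
have [||v [vs _ vE vC]] := @cstar_sqrt1B y => //.
exists (1 - v); split=> [||w wx].
- by rewrite starB star1 vs.
- by rewrite vE yE opprB addrC subrK.
- rewrite mulrBr mulrBl mulr1 mul1r vC// yC// mulrBr mulrBl mulr1 mul1r.
  by rewrite mulrA wx -!mulrA wx.
Qed.

End SquareRoot.

(** * Hilbert spaces and representations *)

Lemma lipschitz_continuous (R : realType) (V W : normedModType R[i])
    (f : V -> W) (k : R[i]) : 0 <= k ->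
  (forall u v, `|f u - f v| <= k * `|u - v|) -> continuous f.
Proof.
move=> k0 fk v; apply/cvgrPdist_le => e e0.
have k1 : 0 < k + 1 by rewrite ltr_wpDl.
near=> w; rewrite (le_trans (fk _ _))//.
apply: (@le_trans _ _ ((k + 1) * `|v - w|)); first by rewrite ler_wpM2r// lerDl.
rewrite mulrC -ler_pdivlMr//; near: w.
by apply: cvgr_dist_le; [exact: cvg_id|rewrite divr_gt0].
Unshelve. all: by end_near. Qed.

Section Hilbert.
Variables (R : realType) (H : hilbertType R).
Implicit Types (u v w : H) (z : R[i]).

Lemma innerC u v : inner u v = (inner v u)^*.
Proof. by rewrite hermC expr0 mul1r. Qed.

Lemma innerDl u v w : inner (u + v) w = inner u w + inner v w.
Proof. exact: linearDl. Qed.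

Lemma innerBl u v w : inner (u - v) w = inner u w - inner v w.
Proof. exact: linearBl. Qed.

Lemma innerZl z u v : inner (z *: u) v = z * inner u v.
Proof. exact: linearZl_LR. Qed.

Lemma innerZr z u v : inner u (z *: v) = z^* * inner u v.
Proof. exact: linearZr_LR. Qed.

Lemma innerBr u v w : inner u (v - w) = inner u v - inner u w.
Proof. exact: linearBr. Qed.

Lemma inner0l u : inner 0 u = 0.
Proof. exact: linear0l. Qed.

Lemma inner0r u : inner u 0 = 0.
Proof. exact: linear0r. Qed.

Lemma inner_eq0 u : inner u u = 0 -> u = 0.
Proof. by move/eqP; rewrite dnorm_eq0 => /eqP. Qed.

(** Cauchy-Schwarz, proved from the projection of u off v: the Hilbert spaces here
    may have infinite dimension. *)
Lemma inner_norm_le u v : `|inner u v| <= `|u| * `|v|.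
Proof.
rewrite -(@ler_pXn2r _ 2) ?nnegrE ?mulr_ge0// exprMn !sqr_norm_inner.
have [->|v0] := eqVneq v 0; first by rewrite !inner0r normr0 expr0n mulr0.
have vv : 0 < inner v v by rewrite dnorm_gt0.
pose w := u - (inner u v / inner v v) *: v.
have wv : inner w v = 0 by rewrite innerBl innerZl mulfVK ?subrr// gt_eqF.
have : 0 <= inner w w by exact: dnorm_ge0.
rewrite {2}/w innerBr innerZr wv mulr0 subr0 innerBl innerZl subr_ge0.
by rewrite mulrAC ler_pdivrMr// [inner v u]innerC -normCK.
Qed.

Lemma closed_orthogonal u : closed [set v | inner v u = 0].
Proof.
have -> : [set v | inner v u = 0] = (fun v => inner v u) @^-1` [set 0].
  by [].
apply: preimage_closed; last first.
  exact/accessible_closed_set1/hausdorff_accessible/norm_hausdorff.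
move=> v _; apply: (@lipschitz_continuous _ H R[i] _ `|u|) => // {}v w.
by rewrite -innerBl mulrC inner_norm_le.
Qed.

End Hilbert.

Section Representation.
Variables (R : realType) (A : cstarAlgType R) (H : hilbertType R).
Variable rho : representation A H.
Implicit Types (x y t : A) (u v : H) (z : R[i]).

Lemma repDr x u v : rho x (u + v) = rho x u + rho x v.
Proof. by have := rep_linear rho x 1 u v; rewrite !scale1r. Qed.

Lemma repZr x z v : rho x (z *: v) = z *: rho x v.
Proof. by have := rep_linear rho x z v 0; rewrite rep0r !addr0. Qed.

Lemma repBr x u v : rho x (u - v) = rho x u - rho x v.
Proof. by rewrite repDr -scaleN1r repZr scaleN1r. Qed.

Lemma repDl x y v : rho (x + y) v = rho x v + rho y v.
Proof. by have := rep_linearl rho v 1 x y; rewrite !scale1r. Qed.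

Lemma rep0l v : rho 0 v = 0.
Proof. by apply: (addIr (rho 0 v)); rewrite -repDl !add0r. Qed.

Lemma repZl z x v : rho (z *: x) v = z *: rho x v.
Proof. by have := rep_linearl rho v z x 0; rewrite rep0l !addr0. Qed.

Lemma repNl x v : rho (- x) v = - rho x v.
Proof. by rewrite -scaleN1r repZl scaleN1r. Qed.

Lemma repBl x y v : rho (x - y) v = rho x v - rho y v.
Proof. by rewrite repDl repNl. Qed.

Lemma rep_starl x u v : inner (rho (star x) u) v = inner u (rho x v).
Proof. by rewrite rep_star starK. Qed.

Lemma rep_self_adjoint_real x v z : star x = x -> v <> 0 ->
  rho x v = z *: v -> z = (complex.Re z)%:C.
Proof.
move=> xs v0 xv; have := rep_star rho x v v.
rewrite xs xv innerZl innerZr => /mulIf zE.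
rewrite RRe_real//; apply/CrealP/esym/zE.
by apply/eqP => /inner_eq0.
Qed.

(** For x of norm 1, write 1 - x^* x = b^2 with b self-adjoint; then
    |v|^2 - |x v|^2 = |b v|^2. *)
Lemma rep_contractive x v : (forall v, rho 1 v = v) ->
  `|rho x v| <= (rnorm x)%:C * `|v|.
Proof.
move=> rho1.
wlog x1 : x / rnorm x = 1 => [unit|].
  have [->|x0] := eqVneq x 0; first by rewrite rep0l normr0 rnorm0 mul0r.
  have k0 : 0 < rnorm x.
    by rewrite lt_def rnorm_ge0 andbT; apply: contra x0 => /eqP/rnorm0_eq0->.
  have E : (rnorm x)%:C * (rnorm x)^-1%:C = 1.
    by rewrite -rmorphM /= divff// gt_eqF.
  have n1 : rnorm ((rnorm x)^-1%:C *: x) = 1.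
    by rewrite rnormZ gtr0_norm ?invr_gt0// mulVf// gt_eqF.
  have := unit ((rnorm x)^-1%:C *: x); rewrite n1 => /(_ erefl).
  rewrite repZl normrZ ger0_norm ?ler0c ?invr_ge0 ?rnorm_ge0//.
  rewrite -(ler_pM2l (_ : 0 < (rnorm x)%:C)) ?ltcR//.
  by rewrite !mulrA E mul1r mulr1.
have [||y [ys _ yE _]] := @cstar_sqrt1B R A (star x * x).
- by rewrite starM starK.
- by rewrite rnorm_cstar x1 expr1n.
rewrite x1 mul1r -(@ler_pXn2r _ 2) ?nnegrE// !sqr_norm_inner.
have bs : star (1 - y) = 1 - y by rewrite starB star1 ys.
rewrite -subr_ge0.
have -> : inner v v - inner (rho x v) (rho x v) =
    inner (rho (1 - y) v) (rho (1 - y) v).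
  rewrite [RHS]rep_star -repM bs yE repBl rho1 repM innerBr.
  by rewrite -rep_star.
exact: dnorm_ge0.
Qed.

(** [t * t] is the absolute value of y, so [t * t + y] is twice its positive part;
    on an eigenvector only the eigenvalues matter. *)
Lemma rep_positive_part t y v (tau eta : R) :
  (t * t) * (t * t) = y * y ->
  rho t v = tau%:C *: v -> rho y v = eta%:C *: v ->
  rho (t * t + y) v = (`|eta| + eta)%:C *: v.
Proof.
move=> ty tv yv; rewrite repDl yv [in RHS]rmorphD /= scalerDl; congr (_ + _).
have [->|v0] := eqVneq v 0; first by rewrite rep0r scaler0.
have : rho ((t * t) * (t * t)) v = rho (y * y) v by rewrite ty.
rewrite !repM !(tv, repZr) yv repZr yv !scalerA -!rmorphM /=.
move/eqP; rewrite -subr_eq0 -scalerBl scaler_eq0 (negPf v0) orbF subr_eq0.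
move=> /eqP/complexI te; congr (_%:C *: _).
apply/eqP; rewrite -(@eqrXn2 _ 2)// -?expr2 ?sqr_ge0//.
by rewrite real_normK ?num_real// !expr2 !mulrA te.
Qed.

End Representation.

(** * Schur's lemma for central elements *)

Section Schur.
Variables (R : realType) (A : cstarAlgType R).
Implicit Types (x y t w : A) (p : irrep A).

(** [p 1] is idempotent with an invariant kernel. *)
Lemma irrep_unital p v : p 1 v = v.
Proof.
have [||K0|KT] := (irrep_irr p).2 [set v | p 1 v = 0].
- split=> [|z u w|x w] /=; first exact: rep0r.
  + by move=> u0 w0; rewrite repDr repZr u0 w0 scaler0 addr0.
  + by move=> w0; rewrite -repM mul1r -[x]mulr1 repM w0 rep0r.
- exact: closed_rep_ker.
- apply/eqP; rewrite -subr_eq0; apply/eqP.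
  have : [set v | p 1 v = 0] (p 1 v - v) by rewrite /= repBr -repM mulr1 subrr.
  by rewrite K0.
- have [[x [w xw]] _] := irrep_irr p; case: xw.
  have : [set v | p 1 v = 0] w by rewrite KT.
  by rewrite /= -[x]mulr1 repM => ->; rewrite rep0r.
Qed.

Lemma irrep_nonzero p : exists v : irrep_space p, v <> 0.
Proof.
have [[x [w xw]] _] := irrep_irr p.
by exists w => w0; apply: xw; rewrite w0 rep0r.
Qed.

(** Subtract from x its mean value mu at some vector v.  For y = x - mu and
    |y| = t^2 the product (y - |y|) (y + |y|) vanishes, and the kernel of p is
    prime, so p y is |p y| or -|p y|.  As the mean value of y at v is 0, t v = 0
    in both cases, and then y v = 0; a central element that kills one nonzero
    vector is in the kernel. *)
Lemma schur_self_adjoint p x : star x = x -> (forall w, w * x = x * w) ->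
  exists r : R, forall v, p x v = r%:C *: v.
Proof.
move=> xs xC; have [v v0] := irrep_nonzero p.
have vv : inner v v != 0 by apply/eqP => /inner_eq0.
pose mu := complex.Re (inner (p x v) v / inner v v).
have muE : mu%:C = inner (p x v) v / inner v v.
  rewrite RRe_real//; apply/CrealP; rewrite fmorph_div /= -!innerC.
  by rewrite rep_star xs.
pose y := x - mu%:C *: 1.
have ys : star y = y by rewrite starB starZr star1 xs.
have yC w : w * y = y * w.
  by rewrite mulrBr mulrBl xC -scalerAr -scalerAl mulr1 mul1r.
have yv : inner (p y v) v = 0.
  by rewrite repBl repZl irrep_unital innerBl innerZl muE mulfVK ?subrr.
suff yp : rep_kernel p y.
  exists mu => u; have := yp u; rewrite repBl repZl irrep_unital.
  by move/eqP; rewrite subr_eq0 => /eqP.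
clearbody y; have [t [ts tE tC]] := cstar_fourth_root ys.
(* Either sign makes the mean value of p y at v equal to |t v|^2 up to sign. *)
have tv0 : p y v = p (t * t) v \/ p y v = - p (t * t) v -> p y v = 0.
  move=> yt; suff tv : p t v = 0.
    by case: yt => ->; rewrite repM tv rep0r ?oppr0.
  apply: inner_eq0; rewrite rep_star ts -repM innerC.
  by case: yt yv => [-> ->|->]; rewrite ?conjC0//;
    rewrite -scaleN1r innerZl => /eqP; rewrite mulN1r oppr_eq0 => /eqP->;
    rewrite conjC0.
apply: (@irrep_annihilator _ _ p y v) => // a.
rewrite -yC repM tv0 ?rep0r//.
have := @primitive_prime R A (prim_of_irrep p) (y - t * t) (y + t * t).
case=> [b|/(_ v)|/(_ v)].
- have {}tC w : w * (t * t) = (t * t) * w.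
    by rewrite mulrA tC// -mulrA tC// mulrA.
  move=> u /=; rewrite -[_ * b](_ : b * (y - t * t) = _); last first.
    by rewrite mulrBr mulrBl yC tC.
  rewrite -mulrA mulrDr !mulrBl tE (yC (t * t)) addrA subrK subrr.
  by rewrite mulr0 rep0l.
- by rewrite repBl => /eqP; rewrite subr_eq0 => /eqP; left.
- by rewrite repDl => /eqP; rewrite addr_eq0 => /eqP; right.
Qed.

Lemma central_star x : (forall w, w * x = x * w) -> forall w, w * star x = star x * w.
Proof. by move=> xC w; apply: (can_inj (@starK _ A)); rewrite !starM !starK xC. Qed.

(** Real and imaginary part of x are central and self-adjoint. *)
Lemma schur p x : (forall w, w * x = x * w) ->
  exists z : R[i], forall v, p x v = z *: v.
Proof.
move=> xC; have sC := central_star xC.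
have [||a aE] := @schur_self_adjoint p (x + star x).
- by rewrite starD starK addrC.
- by move=> w; rewrite mulrDr mulrDl xC sC.
have [||b bE] := @schur_self_adjoint p ('i *: (x - star x)).
- by rewrite starZ starB starK conjCi scaleNr -scalerN opprB.
- by move=> w; rewrite -scalerAr -scalerAl mulrBr mulrBl xC sC.
exists ((2^-1)%:C * (a%:C - 'i * b%:C)) => v.
have -> : x = (2^-1)%:C *: ((x + star x) - 'i *: ('i *: (x - star x))).
  rewrite scalerA -expr2 sqrCi scaleN1r opprK addrACA [star x + _]addrC addNr.
  by rewrite addr0 half_double.
by rewrite repZl repBl repZl aE bE !scalerA -scalerBl scalerA.
Qed.

End Schur.

(** * Density of the algebra generated by alpha and gamma *)

Section ClosedStarSubalgebra.
Variables (R : realType) (A : cstarAlgType R).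

Record closed_star_subalgebra := ClosedStarSubalgebra {
  star_subalg :> A -> Prop;
  star_subalg1 : star_subalg 1;
  star_subalgZD : forall (z : R[i]) x y,
    star_subalg x -> star_subalg y -> star_subalg (z *: x + y);
  star_subalgM : forall x y,
    star_subalg x -> star_subalg y -> star_subalg (x * y);
  star_subalg_star : forall x, star_subalg x -> star_subalg (star x);
  star_subalg_closed : forall x,
    (forall e : R, 0 < e -> exists2 y, star_subalg y & rnorm (x - y) < e) ->
    star_subalg x
}.

Variable S : closed_star_subalgebra.

Definition star_subalg_pred : {pred A} := fun x => `[< S x >].

Fact star_subalg_pred_closed : subalg_closed star_subalg_pred.
Proof.
split=> [|z x y|x y]; rewrite !unfold_in.
- exact/asboolP/star_subalg1.
- by move=> /asboolP Sx /asboolP Sy; apply/asboolP/star_subalgZD.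
- by move=> /asboolP Sx /asboolP Sy; apply/asboolP/star_subalgM.
Qed.

HB.instance Definition _ := GRing.isSubalgClosed.Build R[i] A star_subalg_pred
  star_subalg_pred_closed.

Definition star_subalg_type := {x : A | x \in star_subalg_pred}.

HB.instance Definition _ := SubChoice.on star_subalg_type.
HB.instance Definition _ := [SubChoice_isSubAlgebra of star_subalg_type by <:].

Implicit Types x y : star_subalg_type.

Lemma star_subalgP x : S (val x).
Proof. by have := valP x; rewrite unfold_in => /asboolP. Qed.

Definition star_subalg_elt a (Sa : S a) : star_subalg_type :=
  exist _ a (introT (asboolP (S a)) Sa).

Let cn x := cnorm (val x).
Let st x := star_subalg_elt (star_subalg_star (star_subalgP x)).

Fact sub_cnormD x y : cn (x + y) <= cn x + cn y.
Proof. exact: cnormD. Qed.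

Fact sub_cnormZ (z : R[i]) x : cn (z *: x) = `|z| * cn x.
Proof. exact: cnormZ. Qed.

Fact sub_cnorm_eq0 x : cn x = 0 -> x = 0.
Proof. by move=> /cnorm_eq0 x0; apply: val_inj. Qed.

Fact sub_cnormM x y : cn (x * y) <= cn x * cn y.
Proof. exact: cnormM. Qed.

Fact sub_cnorm_complete (u : nat -> star_subalg_type) :
  (forall e : R[i], 0 < e -> exists N, forall m n,
     (N <= m)%N -> (N <= n)%N -> cn (u m - u n) < e) ->
  exists l, forall e : R[i], 0 < e -> exists N, forall n,
    (N <= n)%N -> cn (u n - l) < e.
Proof.
move=> /(@cnorm_complete R A (val \o u))[l ul].
suff Sl : S l by exists (star_subalg_elt Sl).
apply: star_subalg_closed => e e0; have [|N uN] := ul e%:C; first by rewrite ltcR.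
exists (val (u N)); first exact: star_subalgP.
by rewrite -rnormN opprB -ltcR -cnormE uN.
Qed.

Fact sub_starK : involutive st.
Proof. by move=> x; apply: val_inj; apply: starK. Qed.

Fact sub_starD : {morph st : x y / x + y}.
Proof. by move=> x y; apply: val_inj; apply: starD. Qed.

Fact sub_starZ (z : R[i]) x : st (z *: x) = z^* *: st x.
Proof. by apply: val_inj; apply: starZ. Qed.

Fact sub_starM x y : st (x * y) = st y * st x.
Proof. by apply: val_inj; apply: starM. Qed.

Fact sub_cstar_identity x : cn (st x * x) = cn x ^+ 2.
Proof. exact: cstar_identity. Qed.

HB.instance Definition _ := isCStarAlgebra.Build R star_subalg_type
  sub_cnormD sub_cnormZ sub_cnorm_eq0 sub_cnormM sub_cnorm_complete
  sub_starK sub_starD sub_starZ sub_starM sub_cstar_identity.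

Definition star_subalg_incl : star_subalg_type -> A := val.

Fact star_subalg_incl_linear : linear star_subalg_incl.
Proof. by []. Qed.

Fact star_subalg_incl_multiplicative : monoid_morphism star_subalg_incl.
Proof. by []. Qed.

HB.instance Definition _ := GRing.isLinear.Build R[i] star_subalg_type A *:%R
  star_subalg_incl star_subalg_incl_linear.
HB.instance Definition _ := GRing.isMonoidMorphism.Build star_subalg_type A
  star_subalg_incl star_subalg_incl_multiplicative.

End ClosedStarSubalgebra.

Section Density.
Variables (R : realType) (A : cstarAlgType R) (alpha gamma : A).
Hypothesis A_univ : is_C_SUm1_2 alpha gamma.

(** A closed star-subalgebra S containing the generators is a C*-algebra with a
    solution of the relations.  The universal property gives a map from A to S,
    which followed by the inclusion is the identity of A, by uniqueness. *)
Lemma C_SUm1_2_dense (S : closed_star_subalgebra A) :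
  S alpha -> S gamma -> forall x, S x.
Proof.
move=> Sa Sc x; have [rel univ] := A_univ.
have relS : SUm1_relations (star_subalg_elt Sa) (star_subalg_elt Sc).
  by case: rel => r1 r2 r3 r4 r5; split; apply: val_inj.
have [[f [fs fa fc]] _] := univ _ _ _ relS.
have [_ uniq] := univ _ _ _ rel.
pose g : {lrmorphism A -> A} := @star_subalg_incl R A S \o f.
rewrite (_ : x = val (f x)); first exact: star_subalgP.
apply: (uniq idfun g); split=> //.
- by move=> y; apply: (congr1 val (fs y)).
- exact: (congr1 val fa).
- exact: (congr1 val fc).
Qed.

(** Density as an induction principle.  Closure of I under the involution is
    replaced by the two extra generators: the x with I x and I (star x) form a
    closed star-subalgebra. *)
Lemma C_SUm1_2_ind (I : A -> Prop) :
  I 1 -> (forall (z : R[i]) x y, I x -> I y -> I (z *: x + y)) ->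
  (forall x y, I x -> I y -> I (x * y)) ->
  (forall x, (forall e : R, 0 < e -> exists2 y, I y & rnorm (x - y) < e) -> I x) ->
  (forall g, g \in [:: alpha; gamma; star alpha; star gamma] -> I g) ->
  forall x, I x.
Proof.
move=> I1 IZD IM Icl Ig.
have S1 : I 1 /\ I (star 1) by rewrite star1.
have SZD (z : R[i]) x y : I x /\ I (star x) -> I y /\ I (star y) ->
    I (z *: x + y) /\ I (star (z *: x + y)).
  by move=> [? ?] [? ?]; split; rewrite ?starD ?starZ; apply: IZD.
have SM x y : I x /\ I (star x) -> I y /\ I (star y) ->
    I (x * y) /\ I (star (x * y)).
  by move=> [? ?] [? ?]; split; rewrite ?starM; apply: IM.
have Sstar x : I x /\ I (star x) -> I (star x) /\ I (star (star x)).
  by rewrite starK => -[].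
have Scl x : (forall e : R, 0 < e ->
    exists2 y, I y /\ I (star y) & rnorm (x - y) < e) -> I x /\ I (star x).
  move=> xy; split; apply: Icl => e /xy[y [Iy Iys] ye]; first by exists y.
  by exists (star y) => //; rewrite -starB rnorm_star.
pose S : closed_star_subalgebra A :=
  @ClosedStarSubalgebra R A (fun x => I x /\ I (star x)) S1 SZD SM Sstar Scl.
move=> x; have [||//] := @C_SUm1_2_dense S _ _ x.
- by split; apply: Ig; rewrite !inE eqxx ?orbT.
- by split; apply: Ig; rewrite !inE eqxx ?orbT.
Qed.

End Density.

(** * Matrices with the operator norm *)

Section MatrixCStar.
Variables (R : realType) (n : nat).
Local Notation V := (Cn R n.+1).

(** An alias, so that the structure does not interfere with other norms on
    matrices; the size is positive because C*-algebras are nonzero. *)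
Definition Mn : Type := 'M[R[i]]_n.+1.
HB.instance Definition _ := GRing.Algebra.on Mn.
Implicit Types (M N : Mn) (v w : V).

Let len v : R := complex.Re `|v|.

Let lenE v : `|v| = (len v)%:C.
Proof. by rewrite RRe_real// ger0_real. Qed.

Let len_ge0 v : 0 <= len v.
Proof. by rewrite -ler0c -lenE. Qed.

Let len_eq0 v : len v = 0 -> v = 0.
Proof. by move=> v0; apply: normr0_eq0; rewrite lenE v0. Qed.

Let len0 : len 0 = 0.
Proof. by apply: complexI; rewrite -lenE normr0. Qed.

Let lenD v w : len (v + w) <= len v + len w.
Proof. by rewrite -lecR rmorphD /= -!lenE ler_normD. Qed.

Let sqr_len v : ((len v) ^+ 2)%:C = inner v v.
Proof. by rewrite rmorphXn /= -lenE sqr_norm_inner. Qed.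

Definition mxop M v : V := M *m v.

Let bounds M : set R := [set k | 0 <= k /\ forall v, len (mxop M v) <= k * len v].

(** Locked, since unfolding the infimum makes unification very slow. *)
Fact opnorm_key : unit. Proof. by []. Qed.
Definition opnorm : Mn -> R := locked_with opnorm_key (fun M => inf (bounds M)).

Let opnormE M : opnorm M = inf (bounds M).
Proof. by rewrite /opnorm unlock. Qed.

(** Some bound exists, and it is small when the columns are small. *)
Let opnorm_col M : bounds M (\sum_j len (mxop M (delta_mx j 0))).
Proof.
split=> [|v]; first exact: sumr_ge0.
rewrite {1}[v](_ : v = \sum_j v j 0 *: (delta_mx j 0 : V)); last first.
  by rewrite [LHS]matrix_sum_delta; apply: eq_bigr => j _; rewrite big_ord1.
rewrite /mxop mulmx_sumr -lecR -lenE rmorphM rmorph_sum /= mulr_suml.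
apply: le_trans (ler_norm_sum _ _ _) _; apply: ler_sum => j _.
rewrite -scalemxAr normrZ mulrC -!lenE.
by rewrite ler_wpM2l// Cn_coord_le.
Qed.

Let bounds_lb M : has_lbound (bounds M).
Proof. by exists 0 => k []. Qed.

Lemma opnorm_le M k : 0 <= k -> (forall v, len (mxop M v) <= k * len v) ->
  opnorm M <= k.
Proof. by move=> k0 Mk; rewrite opnormE; apply: ge_inf. Qed.

Lemma opnorm_ge0 M : 0 <= opnorm M.
Proof.
rewrite opnormE; apply: lb_le_inf; last by move=> k [].
by exists (\sum_j len (mxop M (delta_mx j 0))).
Qed.

Lemma opnorm_ub M v : len (mxop M v) <= opnorm M * len v.
Proof.
have [v0|v0] := eqVneq (len v) 0.
  by rewrite (len_eq0 v0) /mxop mulmx0 len0 mulr0.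
have {}v0 : 0 < len v by rewrite lt_def v0 len_ge0.
rewrite -ler_pdivrMr// opnormE; apply: lb_le_inf => [|k [_ Mk]].
  by exists (\sum_j len (mxop M (delta_mx j 0))).
by rewrite ler_pdivrMr.
Qed.

Lemma normr_mxop_le M v : `|mxop M v| <= (opnorm M)%:C * `|v|.
Proof. by rewrite !lenE -rmorphM lecR opnorm_ub. Qed.

Definition adjmx M : Mn := (map_mx Num.conj M)^T.

Lemma adjmxP M v w : inner (mxop M v) w = inner v (mxop (adjmx M) w).
Proof.
rewrite [LHS]/(Cn_inner _ _) [RHS]/(Cn_inner _ _) /Cn_inner.
under eq_bigr => i _ do rewrite mxE mulr_suml.
rewrite exchange_big /=; apply: eq_bigr => j _.
rewrite mxE rmorph_sum mulr_sumr; apply: eq_bigr => i _.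
by rewrite !mxE rmorphM /= conjCK mulrCA mulrA.
Qed.

Fact adjmxK : involutive adjmx.
Proof. by move=> M; apply/matrixP => i j; rewrite !mxE conjCK. Qed.

Fact adjmxD : {morph adjmx : M N / M + N}.
Proof. by move=> M N; apply/matrixP => i j; rewrite !mxE rmorphD. Qed.

Fact adjmxZ (z : R[i]) M : adjmx (z *: M) = z^* *: adjmx M.
Proof. by apply/matrixP => i j; rewrite !mxE rmorphM. Qed.

Fact adjmxM M N : adjmx (M * N) = adjmx N * adjmx M.
Proof.
apply/matrixP => i j; rewrite !mxE rmorph_sum; apply: eq_bigr => k _.
by rewrite !mxE rmorphM mulrC.
Qed.

Let mxopM M N v : mxop (M * N) v = mxop M (mxop N v).
Proof. by rewrite /mxop mulmxA. Qed.

Let opnormM M N : opnorm (M * N) <= opnorm M * opnorm N.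
Proof.
apply: opnorm_le => [|v]; first by rewrite mulr_ge0 ?opnorm_ge0.
rewrite mxopM (le_trans (opnorm_ub _ _))// -mulrA.
by rewrite ler_wpM2l ?opnorm_ge0// opnorm_ub.
Qed.

Let opnormD M N : opnorm (M + N) <= opnorm M + opnorm N.
Proof.
apply: opnorm_le => [|v]; first by rewrite addr_ge0 ?opnorm_ge0.
by rewrite /mxop mulmxDl (le_trans (lenD _ _))// mulrDl lerD// opnorm_ub.
Qed.

Let opnormZ_le (z : R[i]) M : opnorm (z *: M) <= complex.Re `|z| * opnorm M.
Proof.
have zE : `|z| = (complex.Re `|z|)%:C by rewrite RRe_real// ger0_real.
have z0 : 0 <= complex.Re `|z| by rewrite -ler0c -zE.
apply: opnorm_le => [|v]; first by rewrite mulr_ge0 ?opnorm_ge0.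
rewrite -lecR -lenE /mxop -scalemxAl normrZ -mulrA rmorphM /= -zE.
by rewrite ler_wpM2l// lenE lecR opnorm_ub.
Qed.

Let opnormZ (z : R[i]) M : opnorm (z *: M) = complex.Re `|z| * opnorm M.
Proof.
apply/eqP; rewrite eq_le opnormZ_le andTb.
have [->|z0] := eqVneq z 0; first by rewrite normr0 mul0r opnorm_ge0.
have zE : `|z| = (complex.Re `|z|)%:C by rewrite RRe_real// ger0_real.
have zp : 0 < complex.Re `|z| by rewrite -ltcR -zE normr_gt0.
rewrite mulrC -ler_pdivlMr// mulrC.
have zV : `|z^-1| = ((complex.Re `|z|)^-1)%:C.
  rewrite normfV {1}zE; exact/esym/(fmorphV (real_complex R)).
by have := opnormZ_le z^-1 (z *: M); rewrite scalerA mulVf// scale1r zV.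
Qed.

Let opnorm_eq0 M : opnorm M = 0 -> M = 0.
Proof.
move=> M0; apply/matrixP => i j.
have : mxop M (delta_mx j 0) = 0.
  apply: len_eq0; apply/eqP; rewrite eq_le len_ge0 andbT.
  by have := opnorm_ub M (delta_mx j 0); rewrite M0 mul0r.
by rewrite /mxop -colE => /matrixP/(_ i 0); rewrite !mxE.
Qed.

(** |M v|^2 is the inner product of M^* M v and v. *)
Let opnorm_sqr_le M : opnorm M ^+ 2 <= opnorm (adjmx M * M).
Proof.
have k0 := opnorm_ge0 (adjmx M * M).
rewrite -(sqr_sqrtr k0) ler_sqr ?nnegrE ?sqrtr_ge0 ?opnorm_ge0//.
apply: opnorm_le => [|v]; first exact: sqrtr_ge0.
rewrite -ler_sqr ?nnegrE ?mulr_ge0 ?sqrtr_ge0// exprMn sqr_sqrtr//.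
rewrite -lecR sqr_len adjmxP -mxopM.
apply: le_trans (real_ler_norm _) _.
  by rewrite mxopM -adjmxP ger0_real// dnorm_ge0.
rewrite (le_trans (inner_norm_le _ _))// !lenE -rmorphM lecR /=.
by rewrite mulrC expr2 mulrA ler_wpM2r// opnorm_ub.
Qed.

Let opnorm_adj_le M : opnorm M <= opnorm (adjmx M).
Proof.
have [->|M0] := eqVneq (opnorm M) 0; first exact: opnorm_ge0.
rewrite -(ler_pM2r (_ : 0 < opnorm M)) ?lt_def ?M0 ?opnorm_ge0//.
by rewrite -expr2 (le_trans (opnorm_sqr_le _))// opnormM.
Qed.

Let opnorm_adj M : opnorm (adjmx M) = opnorm M.
Proof. by apply/eqP; rewrite eq_le opnorm_adj_le andbT -{2}[M]adjmxK opnorm_adj_le. Qed.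

Let cn M : R[i] := (opnorm M)%:C.

Fact mx_cnormD M N : cn (M + N) <= cn M + cn N.
Proof. by rewrite -rmorphD lecR opnormD. Qed.

Fact mx_cnormZ (z : R[i]) M : cn (z *: M) = `|z| * cn M.
Proof.
by rewrite /cn opnormZ rmorphM; congr (_ * _).
Qed.

Fact mx_cnorm_eq0 M : cn M = 0 -> M = 0.
Proof. by move/complexI/opnorm_eq0. Qed.

Fact mx_cnormM M N : cn (M * N) <= cn M * cn N.
Proof. by rewrite -rmorphM lecR opnormM. Qed.

Fact mx_cstar M : cn (adjmx M * M) = cn M ^+ 2.
Proof.
rewrite -rmorphXn; congr (_%:C); apply/eqP; rewrite eq_le opnorm_sqr_le andbT.
by rewrite expr2 (le_trans (opnormM _ _))// opnorm_adj.
Qed.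

(** The columns converge in C^n, and [opnorm_col] turns this into convergence in
    the operator norm. *)
Fact mx_cnorm_complete (u : nat -> Mn) :
  (forall e : R[i], 0 < e -> exists r : nat, forall k l,
     (r <= k)%N -> (r <= l)%N -> cn (u k - u l) < e) ->
  exists l, forall e : R[i], 0 < e -> exists r : nat, forall k,
    (r <= k)%N -> cn (u k - l) < e.
Proof.
move=> uC; pose col_ j k : V := mxop (u k) (delta_mx j 0).
have cvg_col j : cvgn (col_ j).
  apply/cauchy_cvgP/cauchyP => e e0.
  have k0 : 0 < 1 + `|delta_mx j 0 : V| by rewrite ltr_wpDr.
  have [r ur] := uC _ (divr_gt0 e0 k0).
  exists (col_ j r); exists r => // k /= rk; rewrite -ball_normE /=.
  rewrite /col_ /mxop -mulmxBl.
  have := ur r k (leqnn r) rk; rewrite ltr_pdivlMr//; apply: le_lt_trans.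
  apply: (@le_trans _ _ (cn (u r - u k) * `|delta_mx j 0 : V|)).
    exact: normr_mxop_le.
  by rewrite ler_wpM2l ?lerDr// ler0c opnorm_ge0.
pose l : Mn := \matrix_(i, j) (limn (col_ j)) i 0.
have lE j : mxop l (delta_mx j 0) = limn (col_ j).
  by rewrite /mxop -colE; apply/matrixP => i k; rewrite !mxE (ord1 k).
exists l => e e0.
have eR : e = (complex.Re e)%:C by rewrite RRe_real// gtr0_real.
have d0 : 0 < e / n.+2%:R by rewrite divr_gt0// ltr0n.
have /choice[r uN] : forall j, exists r : nat, forall k, (r <= k)%N ->
    `|limn (col_ j) - col_ j k| < e / n.+2%:R.
  move=> j; have /cvgrPdist_lt/(_ _ d0)[r _ rP] := cvg_col j.
  by exists r => k /rP.
exists (\max_j r j)%N => k rk; apply: (@le_lt_trans _ _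
    (\sum_j `|limn (col_ j) - col_ j k|)).
  rewrite /cn; under eq_bigr => j _ do rewrite lenE.
  rewrite -rmorph_sum lecR opnormE; apply: ge_inf => //.
  have [s0 sP] := opnorm_col (u k - l); split=> [|v]; first exact: sumr_ge0.
  rewrite (le_trans (sP v))// ler_wpM2r//; apply: ler_sum => j _.
  by rewrite /mxop mulmxBl -/(mxop l _) lE -lecR -!lenE distrC.
apply: (@le_lt_trans _ _ (\sum_(j < n.+1) e / n.+2%:R)).
  apply: ler_sum => j _; rewrite ltW// uN// (leq_trans _ rk)//.
  exact: (leq_bigmax j).
rewrite sumr_const card_ord -[ltLHS]mulr_natr mulrAC ltr_pdivrMr ?ltr0n//.
by rewrite ltr_pM2l// ltr_nat.
Qed.

HB.instance Definition _ := isCStarAlgebra.Build R Mn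
  mx_cnormD mx_cnormZ mx_cnorm_eq0 mx_cnormM mx_cnorm_complete
  adjmxK adjmxD adjmxZ adjmxM mx_cstar.

End MatrixCStar.

(** * Representations by matrices *)

Definition acts_by (R : realType) (A : cstarAlgType R) (alpha gamma : A) n
    (M N : 'M[R[i]]_n) (rho : representation A (Cn R n)) : Prop :=
  [/\ forall v, rho 1 v = v, forall v, rho alpha v = M *m v &
      forall v, rho gamma v = N *m v].

Section MatrixRepresentation.
Variables (R : realType) (A : cstarAlgType R) (alpha gamma : A).
Hypothesis A_univ : is_C_SUm1_2 alpha gamma.

Lemma mxop_continuous n (M : Mn R n) : continuous (mxop M).
Proof.
apply: (@lipschitz_continuous _ (Cn R n.+1) (Cn R n.+1) _ (opnorm M)%:C).
  by rewrite ler0c opnorm_ge0.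
by move=> u v; rewrite /mxop -mulmxBr normr_mxop_le.
Qed.

(** The universal property applied to the C*-algebra of matrices. *)
Lemma matrix_representation n (M N : Mn R n) : SUm1_relations M N ->
  exists rho : representation A (Cn R n.+1),
    acts_by alpha gamma M N rho.
Proof.
move=> rel; have [[f [fs fa fc]] _] := A_univ.2 _ _ _ rel.
pose r (x : A) : Cn R n.+1 -> Cn R n.+1 := mxop (f x).
have r1 x : linear (r x).
  by move=> z u v; rewrite /r /mxop mulmxDr scalemxAr.
have r2 x : continuous (r x) by exact: mxop_continuous.
have r3 v : linear (r^~ v).
  by move=> z x y; rewrite /r /mxop linearP mulmxDl scalemxAl.
have r4 x y v : r (x * y) v = r x (r y v).
  by rewrite /r /mxop rmorphM mulmxA.
have r5 x u v : inner (r x u) v = inner u (r (star x) v).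
  by rewrite /r fs adjmxP.
exists (Representation r1 r2 r3 r4 r5); split=> v; rewrite /= /r /mxop.
- by rewrite rmorph1 mul1mx.
- by rewrite fa.
- by rewrite fc.
Qed.

(** The involution is determined by the inner product. *)
Lemma rep_star_mx n (rho : representation A (Cn R n.+1)) x (M : Mn R n) :
  (forall v, rho x v = M *m v) -> forall v, rho (star x) v = adjmx M *m v.
Proof.
move=> xM v; apply: inner_diff_eq0; set w := _ - _.
rewrite {1}/w innerBl rep_starl xM; apply/eqP; rewrite subr_eq0; apply/eqP.
by rewrite [LHS]innerC [RHS]innerC -[M *m w]/(mxop M w) adjmxP.
Qed.

End MatrixRepresentation.

(** * Intertwining operators *)

Section Intertwining.
Variables (R : realType) (A : cstarAlgType R) (alpha gamma : A).
Hypothesis A_univ : is_C_SUm1_2 alpha gamma.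

Lemma norm_le_eq0 (V : normedModType R[i]) (v : V) (k : R[i]) :
  (forall e : R, 0 < e -> `|v| <= k * e%:C) -> v = 0.
Proof.
move=> vk; have k0 : 0 <= k.
  by have := le_trans (normr_ge0 v) (vk 1 ltr01); rewrite mulr1.
have [k' kE] : exists k', k = k'%:C by exists (complex.Re k); rewrite RRe_real// ger0_real.
have [r rE] : exists r, `|v| = r%:C by exists (complex.Re `|v|); rewrite RRe_real// ger0_real.
rewrite {k}kE ler0c in vk k0; apply: normr0_eq0; rewrite rE in vk *.
suff r0 : r <= 0.
  by congr (_%:C); apply/eqP; rewrite eq_le r0 -ler0c -rE normr_ge0.
apply/ler_addgt0Pl => e e0; rewrite addr0.
have k1 : 0 < k' + 1 by rewrite ltr_wpDl.
have := vk _ (divr_gt0 e0 k1); rewrite -rmorphM lecR => /le_trans; apply.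
by rewrite mulrCA ger_pMr// ler_pdivrMr// mul1r lerDl.
Qed.

(** By density it suffices to look at the generators: both sides are linear,
    multiplicative and, by contractivity, continuous in x. *)
Lemma intertwine (H1 H2 : hilbertType R) (r1 : representation A H1)
    (r2 : representation A H2) (U : H1 -> H2) (k : R[i]) :
  (forall v, r1 1 v = v) -> (forall v, r2 1 v = v) ->
  linear U -> (forall v, `|U v| <= k * `|v|) ->
  (forall x, x \in [:: alpha; gamma; star alpha; star gamma] ->
     forall v, U (r1 x v) = r2 x (U v)) ->
  forall x v, U (r1 x v) = r2 x (U v).
Proof.
move=> r11 r21 Ulin Uk Ugen.
have UD u v : U (u + v) = U u + U v by have := Ulin 1 u v; rewrite !scale1r.
have U0 : U 0 = 0 by apply: (addIr (U 0)); rewrite -UD !add0r.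
have UZ z v : U (z *: v) = z *: U v by have := Ulin z v 0; rewrite U0 !addr0.
have UB u v : U (u - v) = U u - U v by rewrite UD -scaleN1r UZ scaleN1r.
apply: (C_SUm1_2_ind A_univ) => [v|z x y Ix Iy v|x y Ix Iy v|x xy v|x /Ugen//].
- by rewrite r11 r21.
- by rewrite !(repDl, repZl) Ulin Ix Iy.
- by rewrite !repM Ix Iy.
apply/eqP; rewrite -subr_eq0; apply/eqP.
apply: (@norm_le_eq0 _ _ (`|k| * `|v| + `|U v|)) => e e0.
have [y Iy ye] := xy e e0.
have -> : U (r1 x v) - r2 x (U v) = U (r1 (x - y) v) - r2 (x - y) (U v).
  by rewrite !repBl UB Iy opprB addrA subrK.
have le_e (H : hilbertType R) (r : representation A H) w :
    (forall v, r 1 v = v) -> `|r (x - y) w| <= e%:C * `|w|.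
  move=> r_1; rewrite (le_trans (rep_contractive _ _ r_1))//.
  by rewrite ler_wpM2r// lecR ltW.
rewrite (le_trans (ler_normB _ _))// mulrDl lerD//; last first.
  by rewrite mulrC le_e.
(* Only when H1 is zero can k fail to be a nonnegative real. *)
have k0 : k * `|r1 (x - y) v| <= `|k| * `|r1 (x - y) v|.
  have [->|w0] := eqVneq (r1 (x - y) v) 0; first by rewrite normr0 !mulr0.
  rewrite ler_wpM2r//; apply: real_ler_norm.
  have : 0 <= k * `|r1 (x - y) v| by apply: le_trans (Uk _).
  by rewrite pmulr_lge0 ?normr_gt0// => /ger0_real.
rewrite (le_trans (Uk _))// (le_trans k0)// -mulrA ler_wpM2l//.
by rewrite mulrC le_e.
Qed.

Section Family.
Variables (n : nat) (H : hilbertType R) (e : 'I_n.+1 -> H).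

(** The synthesis operator of the family e, as in frame theory. *)
Definition synthesis (v : Cn R n.+1) : H := \sum_j v j 0 *: e j.

Lemma synthesis_linear : linear synthesis.
Proof.
move=> z u v; rewrite /synthesis scaler_sumr -big_split /=; apply: eq_bigr => j _.
by rewrite !mxE scalerDl scalerA.
Qed.

Lemma synthesis_delta j : synthesis (delta_mx j 0) = e j.
Proof.
rewrite /synthesis (bigD1 j)//= big1 ?addr0 => [|i ij].
  by rewrite mxE !eqxx scale1r.
by rewrite mxE (negPf ij) /= scale0r.
Qed.

Lemma synthesis_bounded v : `|synthesis v| <= (\sum_j `|e j|) * `|v|.
Proof.
rewrite mulr_suml (le_trans (ler_norm_sum _ _ _))//; apply: ler_sum => j _.
by rewrite normrZ mulrC ler_wpM2l// Cn_coord_le.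
Qed.

Lemma synthesis_mx (M : Mn R n) (T : H -> H) : linear T ->
  (forall j, T (e j) = \sum_i M i j *: e i) ->
  forall v, synthesis (M *m v) = T (synthesis v).
Proof.
move=> Tlin TM v.
have TS (I : seq 'I_n.+1) (f : 'I_n.+1 -> H) :
    T (\sum_(i <- I) f i) = \sum_(i <- I) T (f i).
  apply: big_morph => [u w|]; first by have := Tlin 1 u w; rewrite !scale1r.
  by have := Tlin (-1) 0 0; rewrite !scaleN1r !addNr.
have TZ z u : T (z *: u) = z *: T u.
  have T0 : T 0 = 0 by have := Tlin (-1) 0 0; rewrite !scaleN1r !addNr.
  by have := Tlin z u 0; rewrite T0 !addr0.
rewrite /synthesis TS; under eq_bigr => i _ do rewrite mxE scaler_suml.
rewrite exchange_big /=; apply: eq_bigr => j _.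
rewrite TZ TM scaler_sumr; apply: eq_bigr => i _.
by rewrite scalerA mulrC.
Qed.

Lemma synthesis_intertwine (M N : Mn R n) (pi : representation A (Cn R n.+1))
    (rho : representation A H) :
  (forall v, pi 1 v = v) -> (forall v, rho 1 v = v) ->
  (forall v, pi alpha v = M *m v) -> (forall v, pi gamma v = N *m v) ->
  (forall j, rho alpha (e j) = \sum_i M i j *: e i) ->
  (forall j, rho gamma (e j) = \sum_i N i j *: e i) ->
  (forall j, rho (star alpha) (e j) = \sum_i adjmx M i j *: e i) ->
  (forall j, rho (star gamma) (e j) = \sum_i adjmx N i j *: e i) ->
  forall x v, synthesis (pi x v) = rho x (synthesis v).
Proof.
move=> pi1 rho1 piM piN rM rN rMs rNs.
apply: (intertwine pi1 rho1 synthesis_linear synthesis_bounded) => x.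
rewrite !inE => /or4P[]/eqP-> v.
- by rewrite piM; apply: synthesis_mx => //; apply: rep_linear.
- by rewrite piN; apply: synthesis_mx => //; apply: rep_linear.
- by rewrite (rep_star_mx piM); apply: synthesis_mx => //; apply: rep_linear.
- by rewrite (rep_star_mx piN); apply: synthesis_mx => //; apply: rep_linear.
Qed.

End Family.

(** The orthogonal complement of the range of [synthesis e] is closed and
    invariant, hence zero; so the range is everything. *)
Lemma orthonormal_intertwine_equiv n (pi : representation A (Cn R n.+1))
    (p : irrep A) (e : 'I_n.+1 -> irrep_space p) :
  (forall i j, inner (e i) (e j) = (i == j)%:R) ->
  (forall x v, synthesis e (pi x v) = p x (synthesis e v)) ->
  unitary_equiv pi p.
Proof.
move=> eO eI; exists (synthesis e).
have innerS (h : irrep_space p) v :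
    inner h (synthesis e v) = \sum_j (v j 0)^* * inner h (e j).
  rewrite /synthesis linear_sumr; apply: eq_bigr => j _.
  exact: innerZr.
have innerSl i v : inner (synthesis e v) (e i) = v i 0.
  rewrite innerC innerS (bigD1 i)//= big1 ?addr0 => [|j ji].
    by rewrite eO eqxx mulr1 conjCK.
  by rewrite eO eq_sym (negPf ji) mulr0.
have [||K0|KT] :=
    (irrep_irr p).2 [set h | forall v, inner h (synthesis e v) = 0].
- split=> [v|z u w Ku Kw v|x h Kh v]; first exact: inner0l.
  + by rewrite innerDl innerZl Ku Kw mulr0 addr0.
  + by rewrite rep_star -eI Kh.
- rewrite (_ : [set h | _] =
    \bigcap_(v in setT) [set h | inner h (synthesis e v) = 0]).
    by apply: closed_bigI => v _; apply: closed_orthogonal.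
  by apply/seteqP; split=> h Kh v; [move=> _|]; apply: Kh.
- split; [exact: synthesis_linear| |move=> u v|by []].
    move=> h; pose v : Cn R n.+1 := \col_j inner h (e j).
    exists v; apply/esym/eqP; rewrite -subr_eq0; apply/eqP.
    suff : [set h | forall v, inner h (synthesis e v) = 0] (h - synthesis e v).
      by rewrite K0.
    move=> u /=; rewrite innerS big1// => j _.
    by rewrite innerBl innerSl mxE subrr mulr0.
  rewrite innerS [RHS]/(Cn_inner _ _); apply: eq_bigr => j _.
  by rewrite innerSl mulrC.
- have : [set h | forall v, inner h (synthesis e v) = 0] (e ord0) by rewrite KT.
  move/(_ (delta_mx ord0 0)); rewrite synthesis_delta eO eqxx => /eqP.
  by rewrite oner_eq0.
Qed.

End Intertwining.

(** * Central elements and eigenvectors *)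

Section Relations.
Variables (R : realType) (A : cstarAlgType R) (alpha gamma : A).
Hypothesis rel : SUm1_relations alpha gamma.

Lemma SUm1_alpha_normal : alpha * star alpha = star alpha * alpha.
Proof.
by case: rel => r1 r2 _ _ r5; apply: (addIr (gamma * star gamma)); rewrite r2 r5 r1.
Qed.

Lemma SUm1_star_alpha_gamma : gamma * star alpha = - (star alpha * gamma).
Proof.
case: rel => _ _ _ r4 _; have := congr1 star r4.
by rewrite starM starN starM starK.
Qed.

(** The relations are symmetric in alpha and gamma, so that facts about alpha also
    hold for gamma. *)
Lemma SUm1_relations_swap : SUm1_relations gamma alpha.
Proof.
case: rel => r1 r2 r3 r4 r5; split.
- by rewrite addrC.
- by rewrite addrC.
- by rewrite r3 opprK.
- exact: SUm1_star_alpha_gamma.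
- exact: SUm1_alpha_normal.
Qed.

End Relations.

Section Central.
Variables (R : realType) (A : cstarAlgType R) (alpha gamma : A).
Hypothesis A_univ : is_C_SUm1_2 alpha gamma.

Lemma commute_gens_central x :
  (forall g, g \in [:: alpha; gamma; star alpha; star gamma] -> g * x = x * g) ->
  forall w, w * x = x * w.
Proof.
move=> xC; apply: (C_SUm1_2_ind A_univ) => //.
- by rewrite mulr1 mul1r.
- by move=> z v w vx wx; rewrite mulrDl mulrDr -scalerAl -scalerAr vx wx.
- by move=> v w vx wx; rewrite -mulrA wx mulrA vx mulrA.
move=> w wy; apply: (@rnorm_le_eqC _ _ (rnorm x * 2)) => e /wy[y yx /ltW ye].
rewrite -[w * x](subrK (y * x)) -addrA (le_trans (rnormD _ _))//.
rewrite [in X in _ + X]yx -mulrBr -mulrBl.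
rewrite [leRHS](_ : _ = e * rnorm x + rnorm x * e); last by ring.
rewrite lerD// (le_trans (rnormM _ _))//; first by rewrite ler_wpM2r ?rnorm_ge0.
by rewrite ler_wpM2l ?rnorm_ge0// -rnormN opprB.
Qed.

Lemma anticommute_sqr (x y : A) : x * y = - (y * x) -> x * (y * y) = y * y * x.
Proof. by move=> xy; rewrite mulrA xy mulNr -[y * x * y]mulrA xy mulrN opprK mulrA. Qed.

Lemma central_alpha2 w : w * (alpha * alpha) = alpha * alpha * w.
Proof.
apply: commute_gens_central => g; have rel := A_univ.1.
rewrite !inE => /or4P[]/eqP->; first by rewrite mulrA.
- by apply: anticommute_sqr; case: (SUm1_relations_swap rel).
- by rewrite -[RHS]mulrA (SUm1_alpha_normal rel) !mulrA (SUm1_alpha_normal rel).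
- by apply: anticommute_sqr; case: rel => _ _ _ ->; rewrite opprK.
Qed.

Lemma central_gamma2 w : w * (gamma * gamma) = gamma * gamma * w.
Proof.
apply: commute_gens_central => g; have rel := A_univ.1.
have rel' := SUm1_relations_swap rel.
rewrite !inE => /or4P[]/eqP->.
- by apply: anticommute_sqr; case: rel.
- by rewrite mulrA.
- by apply: anticommute_sqr; case: rel' => _ _ _ ->; rewrite opprK.
- by rewrite -[RHS]mulrA (SUm1_alpha_normal rel') !mulrA (SUm1_alpha_normal rel').
Qed.

End Central.

Section NormalEigenvectors.
Variables (R : realType) (A : cstarAlgType R) (p : irrep A).
Implicit Types (x y : A) (v w : irrep_space p) (z : R[i]).

(** For y = x - z, normality gives |y^* v| = |y v| = 0. *)
Lemma normal_eigenvector_star x v z : x * star x = star x * x ->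
  p x v = z *: v -> p (star x) v = z^* *: v.
Proof.
move=> xN xv; pose y := x - z *: 1.
have ys : star y = star x - z^* *: 1 by rewrite starB starZ star1.
have yN : y * star y = star y * y.
  rewrite ys !mulrBr !mulrBl xN -!scalerAl -!scalerAr !mulr1 !mul1r.
  by rewrite !scalerA [z^* * z]mulrC !opprB addrACA [RHS]addrACA;
    congr (_ + _); rewrite addrC.
have yv : p y v = 0 by rewrite repBl repZl irrep_unital xv subrr.
have : p (star y) v = 0.
  by apply: inner_eq0; rewrite rep_starl -repM yN repM yv rep0r inner0r.
rewrite ys repBl repZl irrep_unital => /eqP.
by rewrite subr_eq0 => /eqP.
Qed.

(** |x^* x v| = |x^2 v| for normal x, and |x v|^2 is the inner product of x^* x v
    and v. *)
Lemma normal_sqr_eq0 x : x * star x = star x * x ->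
  (forall v, p (x * x) v = 0) -> forall v, p x v = 0.
Proof.
move=> xN xx v; have {}xx w : p x (p x w) = 0 by rewrite -repM.
have xsx : p (star x) (p x v) = 0.
  apply: inner_eq0; rewrite rep_starl -[p x (p (star x) _)]repM xN repM xx.
  by rewrite rep0r inner0r.
by apply: inner_eq0; rewrite rep_star xsx inner0r.
Qed.

(** (x - z) (x + z) = 0, so (x + z) w is an eigenvector for z unless it is 0. *)
Lemma sqr_scalar_eigenvector x z : (forall v, p (x * x) v = z ^+ 2 *: v) ->
  forall w, w <> 0 -> exists v, v <> 0 /\ (p x v = z *: v \/ v = w /\ p x v = - z *: v).
Proof.
move=> xz w w0; have [u0|/eqP u0] := eqVneq (p x w + z *: w) 0.
  by exists w; split=> //; right; split=> //; apply/eqP; rewrite scaleNr -addr_eq0 u0.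
exists (p x w + z *: w); split=> //; left.
by rewrite repDr repZr -repM xz scalerDr scalerA expr2 addrC.
Qed.

End NormalEigenvectors.

(** * The representations attached to points of SU(2) *)

Lemma ord2P (Q : 'I_2 -> Prop) : Q ord0 -> Q ord_max -> forall i, Q i.
Proof.
move=> Q0 Q1 [[|[|//]] i2]; [move: Q0|move: Q1]; congr (Q _); exact: val_inj.
Qed.

Lemma big_ord2 (V : nmodType) (F : 'I_2 -> V) :
  \sum_i F i = F ord0 + F ord_max.
Proof. by rewrite big_ord_recl big_ord1; congr (_ + F _); apply: val_inj. Qed.

Section PiMatrices.
Variable R : realType.
Implicit Types (a c : R[i]).

(** The matrices of pi_(a,c) at generic points, considered for all a and c. *)
Definition alpha_mx a : Mn R 1 :=
  \matrix_(i, j) (if i == j then if i == 0 then a else - a else 0).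

Definition gamma_mx c : Mn R 1 := \matrix_(i, j) (if i == j then 0 else c).

Lemma SU2_norm (p : SU2 R) : `|(val p).1| ^+ 2 + `|(val p).2| ^+ 2 = 1.
Proof. by have := valP p; rewrite inE. Qed.

(** The dimension of pi_p depends on p, so statements about pi_p are proved for a
    predicate Q over all dimensions.  The two degenerate cases are merged: if
    a c = 0 then alpha and gamma act by the scalars a and c. *)
Lemma pi_mx_ind (Q : forall n, 'M[R[i]]_n -> 'M[R[i]]_n -> Prop) (p : SU2 R) :
  ((val p).1 * (val p).2 = 0 -> Q 1%N ((val p).1)%:M ((val p).2)%:M) ->
  ((val p).1 != 0 -> (val p).2 != 0 ->
   Q 2%N (alpha_mx (val p).1) (gamma_mx (val p).2)) ->
  Q (pi_dim p) (pi_alpha p) (pi_gamma p).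
Proof.
move=> Q1 Q2; rewrite /pi_dim /pi_alpha /pi_gamma /pi_mx.
move: Q1 Q2; case: (val p) => a c /= Q1 Q2.
have [c0|c0] := eqVneq c 0.
  by rewrite c0 mulr0 raddf0 in Q1; apply: Q1.
have [a0|a0] := eqVneq a 0; last exact: Q2.
by rewrite a0 mul0r raddf0 in Q1; apply: Q1.
Qed.

Lemma alpha_mx_adj a : adjmx (alpha_mx a) = alpha_mx a^*.
Proof.
apply/matrixP => i j; rewrite !mxE eq_sym.
case: eqP => [->|_]; last exact: conjC0.
by case: eqP => // _; rewrite rmorphN.
Qed.

Lemma gamma_mx_adj c : adjmx (gamma_mx c) = gamma_mx c^*.
Proof.
by apply/matrixP => i j; rewrite !mxE eq_sym; case: eqP => // _; rewrite conjC0.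
Qed.

Lemma scalar_mx_adj b : adjmx (b%:M : Mn R 0) = b^*%:M.
Proof. by apply/matrixP => i j; rewrite !mxE !ord1 eqxx. Qed.

Lemma alpha_mxM a b : alpha_mx a * alpha_mx b = (a * b)%:M.
Proof.
apply/matrixP; apply: ord2P; apply: ord2P;
  by rewrite !mxE !big_ord2 !mxE /= ?mulrNN ?mulr0 ?mul0r ?addr0 ?add0r.
Qed.

Lemma gamma_mxM c d : gamma_mx c * gamma_mx d = (c * d)%:M.
Proof.
apply/matrixP; apply: ord2P; apply: ord2P;
  by rewrite !mxE !big_ord2 !mxE /= ?mulrNN ?mulr0 ?mul0r ?addr0 ?add0r.
Qed.

Lemma alpha_gamma_mx a c : alpha_mx a * gamma_mx c = - (gamma_mx c * alpha_mx a).
Proof.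
apply/matrixP; apply: ord2P; apply: ord2P;
  by rewrite !mxE !big_ord2 !mxE /=; ring.
Qed.

Lemma SUm1_relations_mx a c : `|a| ^+ 2 + `|c| ^+ 2 = 1 ->
  SUm1_relations (alpha_mx a) (gamma_mx c).
Proof.
move=> ac1; have sa b : star (alpha_mx b) = alpha_mx b^* := alpha_mx_adj b.
have sg b : star (gamma_mx b) = gamma_mx b^* := gamma_mx_adj b.
split; rewrite ?sa ?sg ?alpha_mxM ?gamma_mxM.
- by rewrite -raddfD /= [a^* * a]mulrC [c^* * c]mulrC -!normCK ac1.
- by rewrite -raddfD /= -!normCK ac1.
- exact: alpha_gamma_mx.
- exact: alpha_gamma_mx.
- by rewrite mulrC.
Qed.

Lemma SUm1_relations_scalar a c : `|a| ^+ 2 + `|c| ^+ 2 = 1 -> a * c = 0 ->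
  SUm1_relations (a%:M : Mn R 0) (c%:M : Mn R 0).
Proof.
move=> ac1 ac0.
have sM b : star (b%:M : Mn R 0) = b^*%:M := scalar_mx_adj b.
have MM b d : (b%:M : Mn R 0) * d%:M = (b * d)%:M.
  exact/esym/scalar_mxM.
have cs0 : a * c^* = 0.
  move/eqP: ac0; rewrite mulf_eq0 => /orP[]/eqP->; rewrite ?mul0r//.
  by rewrite conjC0 mulr0.
split; rewrite ?sM !MM.
- by rewrite -raddfD /= [a^* * a]mulrC [c^* * c]mulrC -!normCK ac1.
- by rewrite -raddfD /= -!normCK ac1.
- by rewrite [c * a]mulrC ac0 raddf0 oppr0.
- by rewrite [c^* * a]mulrC cs0 raddf0 oppr0.
- by rewrite mulrC.
Qed.

End PiMatrices.

Section Classification.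
Variables (R : realType) (A : cstarAlgType R) (alpha gamma : A).
Hypothesis A_univ : is_C_SUm1_2 alpha gamma.

Lemma pi_exists (q : SU2 R) :
  exists rho : representation A (Cn R (pi_dim q)), is_pi alpha gamma rho.
Proof.
apply: (@pi_mx_ind R (fun n M N => exists rho : representation A (Cn R n),
  acts_by alpha gamma M N rho)) => [ac0|a0 c0].
  apply: (matrix_representation A_univ).
  exact: SUm1_relations_scalar (SU2_norm q) ac0.
exact: (matrix_representation A_univ (SUm1_relations_mx (SU2_norm q))).
Qed.

(** In finite dimension irreducibility is the purely algebraic statement. *)
Lemma irreducible_of_delta n (rho : representation A (Cn R n.+1)) :
  (forall v, rho 1 v = v) ->
  (forall K, invariant_subspace rho K -> (exists2 v, K v & v <> 0) ->
     forall j, K (delta_mx j 0)) ->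
  irreducible rho.
Proof.
move=> rho1 Kdelta; split.
  exists 1, (delta_mx ord0 0); rewrite rho1 => /matrixP/(_ ord0 0)/eqP.
  by rewrite !mxE !eqxx oner_eq0.
move=> K Kinv _; have [K0 KZD _] := Kinv.
have [|Kn0] := pselect (exists2 v, K v & v <> 0).
  move=> /(Kdelta K Kinv) Kd; right; apply/seteqP; split=> // v _.
  rewrite (_ : v = synthesis (fun j => delta_mx j 0 : Cn R n.+1) v).
    rewrite /synthesis; elim/big_ind: _ => // [u w Ku Kw|j _].
      by rewrite -[u]scale1r; apply: KZD.
    by rewrite -[_ *: _]addr0; apply: KZD.
  by rewrite [LHS]matrix_sum_delta; apply: eq_bigr => j _; rewrite big_ord1.
left; apply/seteqP; split=> v; last by move=> ->.
by move=> Kv; apply: contrapT => v0; apply: Kn0; exists v.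
Qed.

Lemma subspaceZ n (rho : representation A (Cn R n)) K (z : R[i]) v :
  invariant_subspace rho K -> z != 0 -> K (z *: v) -> K v.
Proof.
move=> [K0 KZD _] z0 Kv; have := KZD z^-1 _ _ Kv K0.
by rewrite addr0 scalerA mulVf// scale1r.
Qed.

(** In dimension 2, the combinations alpha v + a v and alpha v - a v extract the two
    coordinates of v, and gamma carries one basis vector to the other. *)
Lemma pi_irreducible (q : SU2 R) (rho : representation A (Cn R (pi_dim q))) :
  is_pi alpha gamma rho -> irreducible rho.
Proof.
move: rho; apply: (@pi_mx_ind R (fun n M N => forall rho : representation A (Cn R n),
  acts_by alpha gamma M N rho -> irreducible rho)).
  move=> _ rho [rho1 _ _]; apply: irreducible_of_delta => // K Kinv [v Kv v0] j.
  have vE : v = v 0 0 *: delta_mx j 0.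
    by apply/matrixP => i k; rewrite !mxE !ord1 eqxx mulr1.
  apply: (@subspaceZ _ rho K (v 0 0)) => //; last by rewrite -vE.
  by apply/eqP => v00; apply: v0; rewrite vE v00 scale0r.
set a := (val q).1; set c := (val q).2 => a0 c0 rho [rho1 rhoa rhoc].
apply: irreducible_of_delta => // K Kinv [v Kv v0] j.
have [K0 KZD Krho] := Kinv.
have a2 : a + a != 0 by rewrite -mulr2n mulrn_eq0.
have e0 : rho alpha v + a *: v = ((a + a) * v ord0 0) *: delta_mx ord0 0.
  rewrite rhoa; apply/matrixP; apply: ord2P => i;
    rewrite !mxE !big_ord2 !mxE !ord1 /=; ring.
have e1 : rho alpha v - a *: v = (- (a + a) * v ord_max 0) *: delta_mx ord_max 0.
  rewrite rhoa; apply/matrixP; apply: ord2P => i;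
    rewrite !mxE !big_ord2 !mxE !ord1 /=; ring.
have g0 : rho gamma (delta_mx ord0 0) = c *: delta_mx ord_max 0.
  rewrite rhoc; apply/matrixP; apply: ord2P => i;
    rewrite !mxE !big_ord2 !mxE !ord1 /=; ring.
have g1 : rho gamma (delta_mx ord_max 0) = c *: delta_mx ord0 0.
  rewrite rhoc; apply/matrixP; apply: ord2P => i;
    rewrite !mxE !big_ord2 !mxE !ord1 /=; ring.
have [v00|v00] := eqVneq (v ord0 0) 0.
  have v1 : v ord_max 0 != 0.
    apply/eqP => v10; apply: v0; apply/matrixP; apply: ord2P => i;
      by rewrite ord1 mxE.
  have Ke1 : K (delta_mx ord_max 0).
    apply: (@subspaceZ _ rho K (- (a + a) * v ord_max 0)) => //.
      by rewrite mulf_neq0// oppr_eq0.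
    by rewrite -e1 addrC -scaleNr; apply: KZD => //; apply: Krho.
  move: j; apply: ord2P => //; apply: (@subspaceZ _ rho K c) => //.
  by rewrite -g1; apply: Krho.
have Ke0 : K (delta_mx ord0 0).
  apply: (@subspaceZ _ rho K ((a + a) * v ord0 0)) => //.
    by rewrite mulf_neq0.
  by rewrite -e0 addrC; apply: KZD => //; apply: Krho.
move: j; apply: ord2P => //; apply: (@subspaceZ _ rho K c) => //.
by rewrite -g0; apply: Krho.
Qed.

End Classification.

(** * Irreducible representations with given eigenvectors *)

Section EigenvectorsClassify.
Variables (R : realType) (A : cstarAlgType R) (alpha gamma : A).
Hypothesis A_univ : is_C_SUm1_2 alpha gamma.
Variable p : irrep A.
Implicit Types (a c : R[i]) (v w : irrep_space p).
Let rel := A_univ.1.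
Let alphaN := SUm1_alpha_normal rel.
Let gammaN := SUm1_alpha_normal (SUm1_relations_swap rel).

Lemma rep_sum_stars v :
  p (star alpha) (p alpha v) + p (star gamma) (p gamma v) = v.
Proof.
by rewrite -!repM -repDl; case: rel => -> *; rewrite irrep_unital.
Qed.

Lemma rep_anticommute v : p alpha (p gamma v) = - p gamma (p alpha v).
Proof. by rewrite -!repM -repNl; case: rel => _ _ ->. Qed.

Lemma exists_unit_eigenvector (Q : irrep_space p -> Prop) :
  (forall z v, Q v -> Q (z *: v)) -> (exists2 v, v <> 0 & Q v) ->
  exists2 v, inner v v = 1 & Q v.
Proof.
move=> QZ [v v0 Qv].
have n0 : `|v| != 0 by rewrite normr_eq0; apply/eqP.
exists (`|v|^-1 *: v); last exact: QZ.
rewrite -sqr_norm_inner normrZ ger0_norm ?invr_ge0// mulVf//.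
exact: expr1n.
Qed.

(** The first relation, evaluated at v, gives |a|^2 + |c|^2 = 1; anticommutation
    gives a c = - c a. *)
Lemma common_eigenvector a c v : v <> 0 ->
  p alpha v = a *: v -> p gamma v = c *: v ->
  `|a| ^+ 2 + `|c| ^+ 2 = 1 /\ a * c = 0.
Proof.
move=> v0 va vc; have vz (z : R[i]) : z *: v = 0 -> z = 0.
  by move/eqP; rewrite scaler_eq0 => /orP[/eqP//|/eqP/v0].
split.
  apply/eqP; rewrite -subr_eq0; apply/eqP/vz.
  rewrite scalerBl scale1r scalerDl !normCK -!scalerA.
  rewrite -(normal_eigenvector_star alphaN va) -(normal_eigenvector_star gammaN vc).
  by rewrite -!repZr -va -vc rep_sum_stars subrr.
have /eqP := rep_anticommute v.
rewrite vc va !repZr va vc !scalerA [c * a]mulrC -addr_eq0 -scalerDl => /eqP/vz.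
by move/eqP; rewrite -mulr2n mulrn_eq0 => /eqP.
Qed.

Lemma equiv_scalar (pi : representation A (Cn R 1)) a c :
  (forall u, pi 1 u = u) -> (forall u, pi alpha u = a%:M *m u) ->
  (forall u, pi gamma u = c%:M *m u) ->
  (exists2 v, v <> 0 & p alpha v = a *: v /\ p gamma v = c *: v) ->
  unitary_equiv pi p.
Proof.
move=> pi1 pia pic /exists_unit_eigenvector[z v [va vc]|v vv [va vc]].
  by rewrite !repZr va vc !scalerA ![z * _]mulrC.
apply: (@orthonormal_intertwine_equiv _ _ 0 _ _ (fun=> v)) => [i j|].
  by rewrite !ord1 vv eqxx.
apply: (@synthesis_intertwine _ _ _ _ A_univ 0 _ (fun=> v) a%:M c%:M pi p pi1
  (@irrep_unital _ _ p) pia pic) => j;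
  rewrite ?scalar_mx_adj big_ord1 mxE !ord1 eqxx mulr1n//.
  exact: normal_eigenvector_star alphaN va.
exact: normal_eigenvector_star gammaN vc.
Qed.

Section Generic.
Variables (a c : R[i]) (e0 e1 : irrep_space p).
Hypotheses (a0 : a != 0) (c0 : c != 0) (e0a : p alpha e0 = a *: e0).
Hypotheses (ge0 : p gamma e0 = c *: e1) (ge1 : p gamma e1 = c *: e0).

Let e1a : p alpha e1 = - a *: e1.
Proof.
apply: (scalerI c0); rewrite -repZr -ge0 rep_anticommute e0a repZr ge0.
by rewrite !scalerA mulrN scaleNr mulrC.
Qed.

Let sum_eigen : p (star gamma) (e0 + e1) = c^* *: (e0 + e1).
Proof.
apply: normal_eigenvector_star gammaN _.
by rewrite repDr ge0 ge1 scalerDr addrC.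
Qed.

Let diff_eigen : p (star gamma) (e0 - e1) = (- c)^* *: (e0 - e1).
Proof.
apply: normal_eigenvector_star gammaN _.
by rewrite repBr ge0 ge1 scaleNr scalerBr opprB.
Qed.

(** gamma is normal with eigenvectors e0 + e1 and e0 - e1, so its adjoint is known
    on both, hence on e0 and e1. *)
Let star_gamma_e : p (star gamma) e0 = c^* *: e1 /\ p (star gamma) e1 = c^* *: e0.
Proof.
have := sum_eigen; have := diff_eigen; rewrite repBr repDr.
move: (p _ e0) (p _ e1) => X Y; rewrite rmorphN scaleNr => D S.
have XE : X = c^* *: e1.
  rewrite -[X]half_double -[RHS]half_double; congr (_ *: _).
  have -> : X + X = (X + Y) + (X - Y) by rewrite addrACA subrr addr0.
  rewrite S D -[LHS]scalerBr -[RHS]scalerDr; congr (_ *: _).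
  by rewrite opprB [e0 + e1]addrC addrACA subrr addr0.
split=> //; apply: (addrI X); rewrite S scalerDr XE.
by rewrite addrC.
Qed.

Lemma generic_SU2 : e0 <> 0 -> `|a| ^+ 2 + `|c| ^+ 2 = 1.
Proof.
move=> n0; have := rep_sum_stars e0; have [_ gse1] := star_gamma_e.
rewrite e0a ge0 !repZr gse1 (normal_eigenvector_star alphaN e0a) !scalerA.
rewrite -scalerDl -!normCK -{2}[e0]scale1r => /eqP.
by rewrite -subr_eq0 -scalerBl scaler_eq0 subr_eq0 => /orP[/eqP//|/eqP/n0].
Qed.

(** e0 and e1 are eigenvectors of the normal alpha for the distinct values a and
    -a, hence orthogonal, and they have the same length. *)
Lemma equiv_generic_unit (pi : representation A (Cn R 2)) : inner e0 e0 = 1 ->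
  (forall u, pi 1 u = u) -> (forall u, pi alpha u = alpha_mx a *m u) ->
  (forall u, pi gamma u = gamma_mx c *m u) ->
  unitary_equiv pi p.
Proof.
move=> e00 pi1 pia pic; have [gse0 gse1] := star_gamma_e.
pose e (j : 'I_2) := if j == ord0 then e0 else e1.
have e01 : inner e0 e1 = 0.
  have : a * inner e0 e1 = - a * inner e0 e1.
    rewrite -innerZl -e0a rep_star (normal_eigenvector_star alphaN e1a).
    by rewrite innerZr conjCK.
  move/eqP; rewrite mulNr -subr_eq0 opprK -mulr2n mulrn_eq0 /= mulf_eq0.
  by rewrite (negPf a0) => /eqP.
have e11 : inner e1 e1 = 1.
  apply: (mulfI c0); rewrite -innerZl -ge0 rep_star gse1 innerZr conjCK.
  by rewrite e00.
apply: (@orthonormal_intertwine_equiv _ _ 1 _ _ e).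
  apply: ord2P; apply: ord2P; rewrite /e /= ?e00 ?e11 ?e01//.
  by rewrite innerC e01 conjC0.
apply: (@synthesis_intertwine _ _ _ _ A_univ 1 _ e (alpha_mx a) (gamma_mx c) pi p pi1
  (@irrep_unital _ _ p) pia pic); rewrite ?alpha_mx_adj ?gamma_mx_adj;
  apply: ord2P; rewrite big_ord2 /e !mxE /= ?scale0r ?addr0 ?add0r//.
- by rewrite (normal_eigenvector_star alphaN e0a).
- by rewrite (normal_eigenvector_star alphaN e1a) rmorphN.
Qed.

End Generic.

Lemma generic_eigenvector_SU2 a c v : c != 0 -> v <> 0 ->
  p alpha v = a *: v -> p gamma (p gamma v) = c ^+ 2 *: v ->
  `|a| ^+ 2 + `|c| ^+ 2 = 1.
Proof.
move=> c0 v0 va vc; apply: (@generic_SU2 a c v (c^-1 *: p gamma v)) => //.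
  by rewrite scalerA divff// scale1r.
by rewrite repZr vc scalerA expr2 mulKf.
Qed.

Lemma equiv_generic (pi : representation A (Cn R 2)) a c :
  (forall u, pi 1 u = u) -> (forall u, pi alpha u = alpha_mx a *m u) ->
  (forall u, pi gamma u = gamma_mx c *m u) ->
  a != 0 -> c != 0 ->
  (exists2 v, v <> 0 & p alpha v = a *: v /\ p gamma (p gamma v) = c ^+ 2 *: v) ->
  unitary_equiv pi p.
Proof.
move=> pi1 pia pic a0 c0 /exists_unit_eigenvector[z v [va vc]|v vv [va vc]].
  by rewrite !repZr va vc !scalerA ![z * _]mulrC.
apply: (@equiv_generic_unit a c v (c^-1 *: p gamma v)) => //.
  by rewrite scalerA divff// scale1r.
by rewrite repZr vc scalerA expr2 mulKf.
Qed.

(** Since gamma anticommutes with alpha, it exchanges the two eigenspaces. *)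
Lemma exists_alpha_eigenvector a c : c != 0 ->
  (forall v, p (alpha * alpha) v = a ^+ 2 *: v) ->
  (forall v, p (gamma * gamma) v = c ^+ 2 *: v) ->
  exists2 v, v <> 0 & p alpha v = a *: v.
Proof.
move=> c0 a2 c2; have [w w0] := irrep_nonzero p.
have [v [v0 [va|[_ va]]]] := sqr_scalar_eigenvector a2 w0; first by exists v.
exists (p gamma v); last by rewrite rep_anticommute va repZr scaleNr opprK.
move=> gv; have /eqP := c2 v; rewrite repM gv rep0r eq_sym scaler_eq0.
by rewrite sqrf_eq0 (negPf c0) => /eqP.
Qed.

End EigenvectorsClassify.

(** * Classification of the irreducible representations *)

Section Pi.
Variables (R : realType) (A : cstarAlgType R) (alpha gamma : A).
Hypothesis A_univ : is_C_SUm1_2 alpha gamma.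
Implicit Types (q : SU2 R).

Section One.
Variables (q : SU2 R) (rho : representation A (Cn R (pi_dim q))).
Hypothesis rho_pi : is_pi alpha gamma rho.
Let a := (val q).1.
Let c := (val q).2.

Lemma pi_alpha2 v : rho (alpha * alpha) v = a ^+ 2 *: v.
Proof.
move: rho rho_pi v; apply: (@pi_mx_ind R (fun n M N =>
  forall rho : representation A (Cn R n),
  acts_by alpha gamma M N rho ->
  forall v, rho (alpha * alpha) v = a ^+ 2 *: v)) => [_|_ _] r [_ ra _] v.
  by rewrite repM !ra !mul_scalar_mx scalerA.
by rewrite repM !ra mulmxA [alpha_mx _ *m alpha_mx _]alpha_mxM mul_scalar_mx.
Qed.

Lemma pi_gamma2 v : rho (gamma * gamma) v = c ^+ 2 *: v.
Proof.
move: rho rho_pi v; apply: (@pi_mx_ind R (fun n M N =>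
  forall rho : representation A (Cn R n),
  acts_by alpha gamma M N rho ->
  forall v, rho (gamma * gamma) v = c ^+ 2 *: v)) => [_|_ _] r [_ _ rc] v.
  by rewrite repM !rc !mul_scalar_mx scalerA.
by rewrite repM !rc mulmxA [gamma_mx _ *m gamma_mx _]gamma_mxM mul_scalar_mx.
Qed.

Lemma pi_scalar : a * c = 0 ->
  [/\ forall v, rho alpha v = a *: v, forall v, rho gamma v = c *: v &
      forall x, exists z : R[i], forall v, rho x v = z *: v].
Proof.
move=> ac0; move: rho rho_pi; apply: (@pi_mx_ind R (fun n M N =>
  forall rho : representation A (Cn R n),
  acts_by alpha gamma M N rho ->
  [/\ forall v, rho alpha v = a *: v, forall v, rho gamma v = c *: v &
      forall x, exists z : R[i], forall v, rho x v = z *: v])); last first.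
  by move=> a0 c0; move/eqP: ac0; rewrite mulf_eq0 (negPf a0) (negPf c0).
move=> _ r [_ ra rc]; split=> [v|v|x].
- by rewrite ra mul_scalar_mx.
- by rewrite rc mul_scalar_mx.
exists (r x (delta_mx 0 0) 0 0) => v.
have vE : v = v 0 0 *: delta_mx 0 0.
  by apply/matrixP => i j; rewrite !mxE !ord1 eqxx mulr1.
rewrite {1}vE repZr; apply/matrixP => i j; rewrite !mxE !ord1.
by rewrite mulrC.
Qed.

Lemma pi_equiv (p : irrep A) : 
  (a * c = 0 ->
     exists2 v, v <> 0 & p alpha v = a *: v /\ p gamma v = c *: v) ->
  (a != 0 -> c != 0 ->
     exists2 v, v <> 0 & p alpha v = a *: v /\ p gamma (p gamma v) = c ^+ 2 *: v) ->
  unitary_equiv rho p.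
Proof.
move: rho rho_pi; apply: (@pi_mx_ind R (fun n M N =>
  forall rho : representation A (Cn R n),
  acts_by alpha gamma M N rho ->
  _ -> _ -> unitary_equiv rho p)) => [ac0|a0 c0] r [r1 ra rc] P1 P2.
  exact: (equiv_scalar A_univ r1 ra rc (P1 ac0)).
exact: (equiv_generic A_univ r1 ra rc a0 c0 (P2 a0 c0)).
Qed.

End One.

Lemma mk_SU2 (a c : R[i]) : `|a| ^+ 2 + `|c| ^+ 2 = 1 ->
  exists q : SU2 R, val q = (a, c).
Proof. by move=> ac; exists (exist _ (a, c) (mem_set ac)). Qed.

Variable pi : forall q : SU2 R, representation A (Cn R (pi_dim q)).
Hypothesis pi_is : forall q, is_pi alpha gamma (pi q).
Hypothesis pi_irr : forall q, irreducible (pi q).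
Let irr q := Irrep (pi_irr q).

(** With square roots a and c of the scalars alpha^2 and gamma^2: if neither is 0,
    alpha has an eigenvector for a.  If one is 0, the corresponding normal
    operator is 0, and an eigenvector of the other is a common eigenvector. *)
Lemma irrep_classification (p : irrep A) :
  exists q : SU2 R, unitary_equiv (pi q) p.
Proof.
have rel := A_univ.1.
have alphaN := SUm1_alpha_normal rel.
have gammaN := SUm1_alpha_normal (SUm1_relations_swap rel).
have [l lE] := schur p (central_alpha2 A_univ).
have [m mE] := schur p (central_gamma2 A_univ).
rewrite -[l]sqrtCK in lE; rewrite -[m]sqrtCK in mE.
move: (sqrtC l) (sqrtC m) lE mE => a c {l m} a2 c2.
have [w w0] := irrep_nonzero p.
suff [[a' [c' [v [v0 va vc]]]]|[a0 c0]] : (exists a' c' v, [/\ v <> 0,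
    p alpha v = a' *: v & p gamma v = c' *: v]) \/ a != 0 /\ c != 0.
- have [ac1 ac0] := common_eigenvector A_univ v0 va vc.
  have [q qE] := mk_SU2 ac1; exists q; apply: pi_equiv => //; rewrite qE /=.
    by move=> _; exists v.
  by move=> a0 c0; move/eqP: ac0; rewrite mulf_eq0 (negPf a0) (negPf c0).
- have [v v0 va] := exists_alpha_eigenvector A_univ c0 a2 c2.
  have vc : p gamma (p gamma v) = c ^+ 2 *: v by rewrite -repM c2.
  have [q qE] := mk_SU2 (generic_eigenvector_SU2 A_univ c0 v0 va vc).
  exists q; apply: pi_equiv => //; rewrite qE /=; last by exists v.
  by move/eqP; rewrite mulf_eq0 (negPf a0) (negPf c0).
have [c0|c0] := eqVneq c 0.
  left; have g0 : forall v, p gamma v = 0.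
    by apply: normal_sqr_eq0 => // v; rewrite c2 c0 expr0n scale0r.
  have [v [v0 [va|[_ va]]]] := sqr_scalar_eigenvector a2 w0.
    by exists a, 0, v; rewrite scale0r.
  by exists (- a), 0, v; rewrite scale0r.
have [a0|a0] := eqVneq a 0; last by right.
left; have g0 : forall v, p alpha v = 0.
  by apply: normal_sqr_eq0 => // v; rewrite a2 a0 expr0n scale0r.
have [v [v0 [vc|[_ vc]]]] := sqr_scalar_eigenvector c2 w0.
  by exists 0, c, v; rewrite scale0r.
by exists 0, (- c), v; rewrite scale0r.
Qed.

Lemma SU2_simP q q' : SU2_sim_op q q' <->
  if ((val q).1 == 0) || ((val q).2 == 0) then val q' = val q
  else (val q').1 ^+ 2 = (val q).1 ^+ 2 /\ (val q').2 ^+ 2 = (val q).2 ^+ 2.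
Proof.
rewrite /SU2_sim_op; case: (val q) => a c; case: (val q') => b d /=.
case: ifP => _; first by split=> [/eqP|->].
rewrite !inE !xpair_eqE; split.
  by case/or4P => /andP[/eqP-> /eqP->]; rewrite ?sqrrN.
move=> [/eqP + /eqP]; rewrite !eqf_sqr => /orP[]-> /orP[]->; rewrite ?orbT//.
Qed.

(** pi_q' has the same alpha^2 and gamma^2 as pi_q, hence an eigenvector of alpha
    for the value a itself. *)
Lemma pi_sim_equiv q q' : SU2_sim_op q q' -> unitary_equiv (pi q) (pi q').
Proof.
have a2 := pi_alpha2 (pi_is q'); have c2 := pi_gamma2 (pi_is q').
move=> /SU2_simP; case: ifP => [_ /val_inj->|]; first exact: unitary_equiv_refl.
move/negbT; rewrite negb_or => /andP[a0 c0] [aE cE]; rewrite aE in a2.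
rewrite cE in c2; apply: (@pi_equiv q (pi q) (pi_is q) (irr q')).
  by move/eqP; rewrite mulf_eq0 (negPf a0) (negPf c0).
move=> _ _.
have [v v0 va] := @exists_alpha_eigenvector _ _ _ _ A_univ (irr q') _ _ c0 a2 c2.
by exists v => //; rewrite -repM c2.
Qed.

(** A scalar by which x acts can be read off from the kernel. *)
Lemma pi_kernel_sim q q' : rep_kernel (pi q) = rep_kernel (pi q') ->
  SU2_sim_op q q'.
Proof.
move=> ker; have [v v0] := irrep_nonzero (irr q').
have transfer x z z' : (forall v, pi q x v = z *: v) ->
    (forall v, pi q' x v = z' *: v) -> z' = z.
  move=> xz xz'; have : rep_kernel (pi q) (x - z *: 1).
    by move=> u; rewrite repBl repZl xz (@irrep_unital _ _ (irr q)) subrr.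
  rewrite ker => /(_ v); rewrite repBl repZl xz' (@irrep_unital _ _ (irr q')).
  move/eqP; rewrite -scalerBl scaler_eq0 => /orP[|/eqP/v0//].
  by rewrite subr_eq0 => /eqP.
have aE := transfer _ _ _ (pi_alpha2 (pi_is q)) (pi_alpha2 (pi_is q')).
have cE := transfer _ _ _ (pi_gamma2 (pi_is q)) (pi_gamma2 (pi_is q')).
apply/SU2_simP; case: ifP => // ac0.
have {}ac0 : (val q).1 * (val q).2 = 0 by apply/eqP; rewrite mulf_eq0.
have ac0' : (val q').1 * (val q').2 = 0.
  by apply/eqP; rewrite -sqrf_eq0 exprMn aE cE -exprMn ac0 expr0n.
have [qa qc _] := pi_scalar (pi_is q) ac0.
have [qa' qc' _] := pi_scalar (pi_is q') ac0'.
move: (transfer _ _ _ qa qa') (transfer _ _ _ qc qc').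
by case: (val q) (val q') => [? ?] [? ?] /= -> ->.
Qed.

End Pi.

(** * Closedness of the zero sets of algebra elements *)

Section ClosedKernels.
Variables (R : realType) (A : cstarAlgType R) (alpha gamma : A).
Hypothesis A_univ : is_C_SUm1_2 alpha gamma.
Implicit Types (p q : SU2 R) (x y : A).

Lemma SU2_fst_continuous : continuous (fun p : SU2 R => (val p).1 : R[i]).
Proof.
move=> p; apply: continuous_comp; last exact: cvg_fst.
exact: initial_continuous.
Qed.

Lemma SU2_snd_continuous : continuous (fun p : SU2 R => (val p).2 : R[i]).
Proof.
move=> p; apply: continuous_comp; last exact: cvg_snd.
exact: initial_continuous.
Qed.

Lemma closed_zeros (T : topologicalType) (f : T -> R[i]) :
  continuous f -> closed [set p | f p = 0].
Proof.
move=> fc; apply: (@preimage_closed _ _ f [set 0]) => [p _|]; first exact: fc.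
exact/accessible_closed_set1/hausdorff_accessible/norm_hausdorff.
Qed.

Lemma conjC_continuous : continuous (Num.conj : R[i] -> R[i]).
Proof.
apply: (@lipschitz_continuous R R[i] R[i] _ 1) => // u v.
by rewrite -rmorphB norm_conjC mul1r.
Qed.

Lemma continuous_mulc (T : topologicalType) (f g : T -> R[i]) :
  continuous f -> continuous g -> continuous (fun t => f t * g t).
Proof.
move=> fc gc t.
exact: (@cvgM (R[i] : numFieldType) _ _ _ f g _ _ (fc t) (gc t)).
Qed.

Lemma continuous_addc (T : topologicalType) (f g : T -> R[i]) :
  continuous f -> continuous g -> continuous (fun t => f t + g t).
Proof. by move=> fc gc t; apply: cvgD; [exact: fc|exact: gc]. Qed.

Lemma continuous_oppc (T : topologicalType) (f : T -> R[i]) :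
  continuous f -> continuous (fun t => - f t).
Proof. by move=> fc t; apply: cvgN; exact: fc. Qed.

Lemma continuous_conjc (T : topologicalType) (f : T -> R[i]) :
  continuous f -> continuous (fun t => (f t)^* ).
Proof.
by move=> fc t; apply: continuous_comp; [exact: fc|exact: conjC_continuous].
Qed.

Lemma uniform_limit_continuous (T : topologicalType) (f : T -> R[i]) :
  (forall e : R, 0 < e -> exists2 g : T -> R[i], continuous g &
     forall t, `|f t - g t| <= e%:C) ->
  continuous f.
Proof.
move=> fg t; apply/cvgrPdist_le => e e0.
have eR : e = (complex.Re e)%:C by rewrite RRe_real// gtr0_real.
have d0 : 0 < complex.Re e / 3 by rewrite divr_gt0// -ltcR -eR.
have [g gc gf] := fg _ d0.
have /cvgrPdist_le/(_ (complex.Re e / 3)%:C) := gc t.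
rewrite ltcR => /(_ d0); apply: filterS => u gtu.
have eE : e = (complex.Re e / 3)%:C + (complex.Re e / 3)%:C + (complex.Re e / 3)%:C.
  by rewrite -!rmorphD /= {1}eR; congr (_%:C); lra.
rewrite eE (_ : _ - _ = (f t - g t) + (g t - g u) - (f u - g u)); last by ring.
rewrite (le_trans (ler_normB _ _))// lerD//.
by rewrite (le_trans (ler_normD _ _))// lerD.
Qed.

(** T_(a,c): the generic formulas, at every point of SU(2). *)
Variable T : SU2 R -> representation A (Cn R 2).
Hypothesis T1 : forall p v, T p 1 v = v.
Hypothesis Talpha : forall p v, T p alpha v = alpha_mx (val p).1 *m v.
Hypothesis Tgamma : forall p v, T p gamma v = gamma_mx (val p).2 *m v.

Definition entry x (i j : 'I_2) p : R[i] := T p x (delta_mx j 0) i 0.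

(** True for the generators and preserved by sums and products; contractivity makes
    limits in the algebra uniform on SU(2). *)
Lemma entry_continuous x i j : continuous (entry x i j).
Proof.
move: x i j; apply: (C_SUm1_2_ind A_univ).
- move=> i j; rewrite [entry _ _ _](_ : _ = cst ((delta_mx j 0 : 'cV[R[i]]_2) i 0)).
    exact: cst_continuous.
  by apply/funext => p; rewrite /entry T1.
- move=> z x y Ix Iy i j.
  rewrite [entry _ _ _](_ : _ = fun p => z * entry x i j p + entry y i j p).
    apply: continuous_addc; last exact: Iy.
    by apply: continuous_mulc; [exact: cst_continuous|exact: Ix].
  by apply/funext => p; rewrite /entry repDl repZl !mxE.
- move=> x y Ix Iy i j.
  rewrite [entry _ _ _](_ : _ = fun p => entry x i ord0 p * entry y ord0 j p +
      entry x i ord_max p * entry y ord_max j p).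
    by apply: continuous_addc; apply: continuous_mulc; [exact: Ix|exact: Iy|exact: Ix|exact: Iy].
  apply/funext => p; rewrite /entry repM.
  rewrite [in LHS](_ : T p y (delta_mx j 0) =
    entry y ord0 j p *: delta_mx ord0 0 + entry y ord_max j p *: delta_mx ord_max 0).
    by rewrite repDr !repZr !mxE ![entry y _ _ _ * _]mulrC.
  by rewrite [LHS]matrix_sum_delta big_ord2 !big_ord1.
- move=> x xy i j; apply: uniform_limit_continuous => e e0.
  have [y Iy /ltW xye] := xy _ e0; exists (entry y i j) => // q.
  have -> : entry x i j q - entry y i j q = (T q (x - y) (delta_mx j 0)) i 0.
    by rewrite repBl !mxE.
  rewrite (le_trans (Cn_coord_le _ _))// (le_trans (rep_contractive _ _ (T1 q)))//.
  have -> : `|delta_mx j 0 : Cn R 2| = 1.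
    apply/eqP; rewrite -(@eqrXn2 _ 2)// expr1n sqr_norm_inner.
    rewrite [X in X == _]/(Cn_inner _ _) /Cn_inner (bigD1 j)//= big1 => [|k kj].
      by rewrite mxE !eqxx conjC1 mulr1 addr0.
    by rewrite mxE (negPf kj) mul0r.
  by rewrite mulr1 lecR.
- have alpha_c (g : SU2 R -> R[i]) : continuous g ->
      forall i j, continuous (fun p => alpha_mx (g p) i j).
    move=> gc i j; rewrite (_ : (fun p => _) =
      if i == j then if i == 0 then g else (fun p => - g p) else cst 0).
      case: (i == j); last exact: cst_continuous.
      by case: (i == 0); [exact: gc|exact: continuous_oppc].
    by apply/funext => p; rewrite mxE; case: ifP => // _; case: ifP.
  have gamma_c (g : SU2 R -> R[i]) : continuous g ->
      forall i j, continuous (fun p => gamma_mx (g p) i j).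
    move=> gc i j; rewrite (_ : (fun p => _) = if i == j then cst 0 else g).
      by case: (i == j); [exact: cst_continuous|exact: gc].
    by apply/funext => p; rewrite mxE; case: ifP.
  have entryE x (M : SU2 R -> Mn R 1) : (forall p v, T p x v = M p *m v) ->
      forall i j, entry x i j = fun p => M p i j.
    by move=> TM i j; apply/funext => p; rewrite /entry TM -colE mxE.
  move=> x; rewrite !inE => /or4P[]/eqP-> i j.
  + by rewrite (entryE _ _ Talpha); apply/alpha_c/SU2_fst_continuous.
  + by rewrite (entryE _ _ Tgamma); apply/gamma_c/SU2_snd_continuous.
  + rewrite (entryE _ (fun p => alpha_mx ((val p).1)^*)).
      by apply/alpha_c/continuous_conjc/SU2_fst_continuous.
    by move=> p v; rewrite (rep_star_mx (Talpha p)) alpha_mx_adj.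
  + rewrite (entryE _ (fun p => gamma_mx ((val p).2)^*)).
      by apply/gamma_c/continuous_conjc/SU2_snd_continuous.
    by move=> p v; rewrite (rep_star_mx (Tgamma p)) gamma_mx_adj.
Qed.

Section Kernels.
Variables (q : SU2 R) (rho : representation A (Cn R (pi_dim q))).
Hypothesis rho_pi : is_pi alpha gamma rho.
Let a := (val q).1.
Let c := (val q).2.

(** Off the two circles, T is pi. *)
Lemma generic_kernel x : a != 0 -> c != 0 ->
  (rep_kernel rho x <-> forall i j, entry x i j q = 0).
Proof.
move=> a0 c0; move: rho rho_pi; apply: (@pi_mx_ind R (fun n M N =>
  forall rho : representation A (Cn R n),
  acts_by alpha gamma M N rho ->
  (rep_kernel rho x <-> forall i j, entry x i j q = 0))).
  by move=> /eqP; rewrite mulf_eq0 (negPf a0) (negPf c0).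
move=> _ _ r [r1 ra rc].
have rT v : r x v = T q x v.
  apply: (@intertwine _ _ _ _ A_univ (Cn R 2) (Cn R 2) r (T q) idfun 1) => //.
    by move=> u; rewrite mul1r.
  move=> y; rewrite !inE => /or4P[]/eqP-> u /=.
  - by rewrite ra Talpha.
  - by rewrite rc Tgamma.
  - by rewrite (rep_star_mx ra) (rep_star_mx (Talpha q)).
  - by rewrite (rep_star_mx rc) (rep_star_mx (Tgamma q)).
split=> [xr i j|xT v]; first by rewrite /entry -rT xr mxE.
rewrite rT [v]matrix_sum_delta big_ord2 !big_ord1 repDr !repZr.
by apply/matrixP => i j; rewrite !mxE (ord1 j) [X in _ * X + _](xT i ord0)
  [X in _ + _ * X](xT i ord_max) !mulr0 addr0.
Qed.

(** At a degenerate point, w spans a line on which T acts by the character pi_q.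
    The adjoints are listed separately because T is reducible there. *)
Lemma scalar_kernel x (w : Cn R 2) : a * c = 0 -> w ord0 0 = 1 ->
  alpha_mx a *m w = a *: w -> gamma_mx c *m w = c *: w ->
  alpha_mx a^* *m w = a^* *: w -> gamma_mx c^* *m w = c^* *: w ->
  (rep_kernel rho x <-> T q x w ord0 0 = 0).
Proof.
move=> ac0 w1 aw cw asw csw; move: rho rho_pi; apply: (@pi_mx_ind R (fun n M N =>
  forall rho : representation A (Cn R n),
  acts_by alpha gamma M N rho ->
  (rep_kernel rho x <-> T q x w ord0 0 = 0))); last first.
  by move=> a0 c0; move/eqP: ac0; rewrite mulf_eq0 (negPf a0) (negPf c0).
move=> _ r [r1 ra rc].
have Tx v : synthesis (fun=> w) (r x v) = T q x (synthesis (fun=> w) v).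
  apply: (@synthesis_intertwine _ _ _ _ A_univ 0 _ (fun=> w) a%:M c%:M r (T q)) => //
    j; rewrite ?scalar_mx_adj big_ord1 mxE !ord1 eqxx mulr1n.
  - by rewrite Talpha.
  - by rewrite Tgamma.
  - by rewrite (rep_star_mx (Talpha q)) alpha_mx_adj.
  - by rewrite (rep_star_mx (Tgamma q)) gamma_mx_adj.
have wE (v : Cn R 1) : synthesis (fun=> w) v = v 0 0 *: w by rewrite /synthesis big_ord1.
split=> [xr|Tx0 v].
  have := Tx (delta_mx 0 0); rewrite !wE xr !mxE !eqxx scale0r scale1r => <-.
  by rewrite mxE.
have := congr1 (fun M : 'cV[R[i]]_2 => M ord0 0) (Tx v).
rewrite !wE repZr !mxE w1 mulr1 Tx0 mulr0 => rv.
by apply/matrixP => i j; rewrite !ord1 rv mxE.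
Qed.

(** Here alpha is diagonal and gamma vanishes: the first basis vector works. *)
Lemma kernel_c0 x : c = 0 -> (rep_kernel rho x <-> entry x ord0 ord0 q = 0).
Proof.
move=> c0; apply: scalar_kernel; rewrite ?c0 ?mulr0 ?mxE ?eqxx//.
all: by apply/matrixP; apply: ord2P => j; rewrite !mxE big_ord2 !mxE !ord1 /= ?conjC0; ring.
Qed.

(** Here gamma is a multiple of the flip: the sum of the basis vectors works. *)
Lemma kernel_a0 x : a = 0 ->
  (rep_kernel rho x <-> entry x ord0 ord0 q + entry x ord0 ord_max q = 0).
Proof.
move=> a0; rewrite (_ : _ + _ = T q x (delta_mx ord0 0 + delta_mx ord_max 0) ord0 0);
  last by rewrite repDr !mxE.
apply: scalar_kernel; rewrite ?a0 ?mul0r ?mxE ?eqxx ?addr0//.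
all: by apply/matrixP; apply: ord2P => j; rewrite !mxE big_ord2 !mxE !ord1 /= ?conjC0; ring.
Qed.

End Kernels.

(** Vanishing of T_q x forces pi_q x = 0 at every q, so the first piece may be taken
    over all of SU(2); this is what makes each of the three pieces closed. *)
Lemma closed_kernel (pi : forall q, representation A (Cn R (pi_dim q)))
    (pi_is : forall q, is_pi alpha gamma (pi q)) x :
  closed [set q | rep_kernel (pi q) x].
Proof.
have -> : [set q | rep_kernel (pi q) x] =
    (\bigcap_(ij in [set: 'I_2 * 'I_2]) [set q | entry x ij.1 ij.2 q = 0]) `|`
    ([set q | (val q).2 = 0] `&` [set q | entry x ord0 ord0 q = 0]) `|`
    ([set q | (val q).1 = 0] `&`
     [set q | entry x ord0 ord0 q + entry x ord0 ord_max q = 0]).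
  apply/seteqP; split=> q /=.
    have [c0|c0] := eqVneq (val q).2 0; first by move/(kernel_c0 (pi_is q) x c0); left; right.
    have [a0|a0] := eqVneq (val q).1 0; first by move/(kernel_a0 (pi_is q) x a0); right.
    by move/(generic_kernel (pi_is q) x a0 c0) => xq; left; left => -[i j] _; exact: xq.
  move=> [[xq|[c0 xq]]|[a0 xq]]; last 2 first.
  - by apply/(kernel_c0 (pi_is q)).
  - by apply/(kernel_a0 (pi_is q)).
  have xij i j : entry x i j q = 0 by apply: (xq (i, j)).
  have [c0|c0] := eqVneq (val q).2 0; first exact/(kernel_c0 (pi_is q)).
  have [a0|a0] := eqVneq (val q).1 0; last exact/(generic_kernel (pi_is q)).
  by apply/(kernel_a0 (pi_is q)) => //; rewrite !xij addr0.
apply: closedU; first apply: closedU.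
- by apply: closed_bigI => ij _; apply: closed_zeros; exact: entry_continuous.
- apply: closedI; apply: closed_zeros; first exact: SU2_snd_continuous.
  exact: entry_continuous.
- apply: closedI; apply: closed_zeros; first exact: SU2_fst_continuous.
  by apply: continuous_addc; exact: entry_continuous.
Qed.

End ClosedKernels.

(** * Separating a point from the complement of a neighbourhood *)

Section Separation.
Variables (R : realType) (A : cstarAlgType R) (alpha gamma : A).
Hypothesis A_univ : is_C_SUm1_2 alpha gamma.
Implicit Types (p q : SU2 R) (x y : A) (b d : R[i]).

Lemma rep_star_scalar (H : hilbertType R) (rho : representation A H) x (z : R[i]) :
  (forall v, rho x v = z *: v) -> forall v, rho (star x) v = z^* *: v.
Proof.
move=> xz v; apply: inner_diff_eq0; set w := _ - _.
by rewrite {1}/w innerBl rep_starl xz innerZr innerZl subrr.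
Qed.

Lemma SU2_ball (O : set (SU2 R)) q : open O -> O q ->
  exists2 e : R, 0 < e & forall p,
    `|(val p).1 - (val q).1| < e%:C -> `|(val p).2 - (val q).2| < e%:C -> O p.
Proof.
move=> [B oB <-] /= Bq; have /nbhs_ballP[e /= e0 eB] : nbhs (val q) B.
  exact: open_nbhs_nbhs.
have eR : e = (complex.Re e)%:C by rewrite RRe_real// gtr0_real.
exists (complex.Re e) => [|p p1 p2]; first by rewrite -ltcR -eR.
by apply: eB; split; rewrite -ball_normE /= distrC eR.
Qed.

(** The squared distances between squares see a point only up to signs. *)
Let sqdist b d p := `|(val p).1 ^+ 2 - b ^+ 2| ^+ 2 + `|(val p).2 ^+ 2 - d ^+ 2| ^+ 2.
Let dist b d p := `|(val p).1 - b| ^+ 2 + `|(val p).2 - d| ^+ 2.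

(** |a - b| |a + b| < e^2 makes one of the factors less than e. *)
Lemma sqrt_near (a b e : R[i]) : 0 < e -> `|a ^+ 2 - b ^+ 2| < e ^+ 2 ->
  exists2 a', a' ^+ 2 = a ^+ 2 & `|a' - b| < e.
Proof.
move=> e0 ab; have [ae|ae] := boolP (`|a - b| < e); first by exists a.
exists (- a); rewrite ?sqrrN// -opprD normrN.
rewrite -real_leNgt ?normr_real ?gtr0_real// in ae.
rewrite real_ltNge ?normr_real ?gtr0_real//; apply/negP => ae'.
suff : e ^+ 2 < e ^+ 2 by rewrite ltxx.
by apply: le_lt_trans ab; rewrite subr_sqr normrM expr2 ler_pM// ltW.
Qed.

Lemma sqdist_near (O : set (SU2 R)) q : open O -> O q ->
  exists2 e : R, 0 < e & forall p, sqdist (val q).1 (val q).2 p < e%:C ->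
    exists p', [/\ O p', (val p').1 ^+ 2 = (val p).1 ^+ 2 &
                   (val p').2 ^+ 2 = (val p).2 ^+ 2].
Proof.
move=> oO Oq; have [e e0 eO] := SU2_ball oO Oq.
exists (e ^+ 4) => [|p pe]; first exact: exprn_gt0.
have e0' : 0 < e%:C by rewrite ltcR.
have sqr_lt (u v : R[i]) : `|u| ^+ 2 + `|v| ^+ 2 < (e ^+ 4)%:C -> `|u| < e%:C ^+ 2.
  move=> uv; rewrite -(@ltr_pXn2r _ 2) ?nnegrE// ?exprn_ge0 ?ltW// -exprM.
  have -> : e%:C ^+ (2 * 2) = (e ^+ 4)%:C by rewrite rmorphXn.
  by apply: le_lt_trans uv; rewrite lerDl exprn_ge0.
have [a' a2 a'e] := sqrt_near e0' (sqr_lt _ _ pe).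
have [|c' c2 c'e] := sqrt_near e0' (sqr_lt ((val p).2 ^+ 2 - (val q).2 ^+ 2)
    ((val p).1 ^+ 2 - (val q).1 ^+ 2) _); first by rewrite addrC.
have [p' p'E] : exists p', val p' = (a', c') :> R[i] * R[i].
  by apply: mk_SU2; rewrite -!normrX a2 c2 !normrX SU2_norm.
by exists p'; split; rewrite ?p'E//; apply: eO; rewrite p'E.
Qed.

Lemma dist_near (O : set (SU2 R)) q : open O -> O q ->
  exists2 e : R, 0 < e & forall p, dist (val q).1 (val q).2 p < e%:C -> O p.
Proof.
move=> oO Oq; have [e e0 eO] := SU2_ball oO Oq.
exists (e ^+ 2) => [|p pe]; first exact: exprn_gt0.
have sqr_lt (u v : R[i]) : `|u| ^+ 2 + `|v| ^+ 2 < (e ^+ 2)%:C -> `|u| < e%:C.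
  move=> uv; rewrite -(@ltr_pXn2r _ 2) ?nnegrE// ?ler0c ?ltW//.
  have -> : e%:C ^+ 2 = (e ^+ 2)%:C by rewrite rmorphXn.
  by apply: le_lt_trans uv; rewrite lerDl exprn_ge0.
by apply: eO; [apply: sqr_lt pe|apply: (sqr_lt _ ((val p).1 - (val q).1)); rewrite addrC].
Qed.

Variable pi : forall q : SU2 R, representation A (Cn R (pi_dim q)).
Hypothesis pi_is : forall q, is_pi alpha gamma (pi q).
Hypothesis pi_irr : forall q, irreducible (pi q).
Let irr q := Irrep (pi_irr q).

Let pi_scalarB q x (z b : R[i]) : (forall v, pi q x v = z *: v) ->
  forall v, pi q (x - b *: 1) v = (z - b) *: v.
Proof. by move=> xz v; rewrite repBl repZl xz (@irrep_unital _ _ (irr q)) scalerBl. Qed.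

Let pi_modulus q x (z : R[i]) : (forall v, pi q x v = z *: v) ->
  forall v, pi q (star x * x) v = `|z| ^+ 2 *: v.
Proof.
by move=> xz v; rewrite repM xz (rep_star_scalar xz) scalerA normCK mulrC.
Qed.

(** |x - b|^2 + |y - d|^2 as an element of the algebra. *)
Let deviation x y b d : A :=
  star (x - b *: 1) * (x - b *: 1) + star (y - d *: 1) * (y - d *: 1).

Let deviation_star x y b d : star (deviation x y b d) = deviation x y b d.
Proof. by rewrite /deviation starD !starM !starK. Qed.

Let pi_deviation q x y b d (z w : R[i]) :
  (forall v, pi q x v = z *: v) -> (forall v, pi q y v = w *: v) ->
  forall v, pi q (deviation x y b d) v = (`|z - b| ^+ 2 + `|w - d| ^+ 2) *: v.
Proof.
move=> xz yw v; rewrite repDl (pi_modulus (pi_scalarB b xz)).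
by rewrite (pi_modulus (pi_scalarB d yw)) scalerDl.
Qed.

(** Twice the positive part of [e - x], evaluated at the points of S.  The hypothesis
    asks for the root t to act by scalars there: Schur's lemma provides this when
    x is central, dimension one when it is not. *)
Lemma positive_part (S : set (SU2 R)) x (e : R) : star x = x ->
  (forall t, star t = t -> (forall w, w * x = x * w -> w * t = t * w) ->
     forall q, S q -> exists z : R[i], forall v, pi q t v = z *: v) ->
  exists u, forall q (r : R), S q -> (forall v, pi q x v = r%:C *: v) ->
    forall v, pi q u v = (`|e - r| + (e - r))%:C *: v.
Proof.
move=> xs tS; have ys : star (e%:C *: 1 - x) = e%:C *: 1 - x.
  by rewrite starB starZr star1 xs.
have [t [ts tE tC]] := cstar_fourth_root ys.
exists (t * t + (e%:C *: 1 - x)) => q r Sq xr v.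
have [|z tz] := tS t ts _ q Sq.
  move=> w wx; apply: tC; rewrite mulrBr mulrBl wx -scalerAl -scalerAr.
  by rewrite mul1r mulr1.
have [u u0] := irrep_nonzero (irr q).
have zR := @rep_self_adjoint_real _ _ _ (pi q) t u z ts u0 (tz u).
apply: (@rep_positive_part _ _ _ (pi q) t _ v (complex.Re z) (e - r)) => //.
  by rewrite -zR.
by rewrite repBl repZl xr (@irrep_unital _ _ (irr q)) -scalerBl rmorphB.
Qed.

Lemma sqdist_bump b d (e : R) : exists u, forall q (r : R),
  r%:C = sqdist b d q -> forall v, pi q u v = (`|e - r| + (e - r))%:C *: v.
Proof.
pose x := deviation (alpha * alpha) (gamma * gamma) (b ^+ 2) (d ^+ 2).
have subC y z : (forall w, w * y = y * w) ->
    forall w, w * (y - z *: 1) = (y - z *: 1) * w.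
  by move=> yC w; rewrite mulrBr mulrBl yC -scalerAl -scalerAr mul1r mulr1.
have modC y : (forall w, w * y = y * w) -> forall w, w * (star y * y) = star y * y * w.
  by move=> yC w; rewrite mulrA (central_star yC) -mulrA yC mulrA.
have xC w : w * x = x * w.
  by rewrite mulrDr mulrDl !modC//; apply: subC;
    [exact: (central_gamma2 A_univ)|exact: (central_alpha2 A_univ)].
have [||u uP] := @positive_part setT x e; first exact: deviation_star.
  move=> t ts tC q _; have [r rP] := @schur_self_adjoint _ _ (irr q) t ts (fun w => tC w (xC w)).
  by exists r%:C.
exists u => q r rE; apply: uP => // v.
by rewrite rE; apply: pi_deviation; [exact: pi_alpha2|exact: pi_gamma2].
Qed.

Lemma dist_bump b d (e : R) : exists u, forall q (r : R),
  (val q).1 * (val q).2 = 0 -> r%:C = dist b d q ->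
  forall v, pi q u v = (`|e - r| + (e - r))%:C *: v.
Proof.
have [||u uP] := @positive_part [set q | (val q).1 * (val q).2 = 0]
    (deviation alpha gamma b d) e; first exact: deviation_star.
  by move=> t _ _ q q0; have [_ _] := pi_scalar (pi_is q) q0; apply.
exists u => q r q0 rE; apply: uP => // v; rewrite rE.
by have [qa qc _] := pi_scalar (pi_is q) q0; exact: pi_deviation.
Qed.

Lemma nnegc_real (z : R[i]) : 0 <= z -> exists2 r : R, 0 <= r & r%:C = z.
Proof.
move=> z0; exists (complex.Re z); last by rewrite RRe_real// ger0_real.
by rewrite -ler0c RRe_real// ger0_real.
Qed.

Lemma sim_generic p p' : (val p).1 != 0 -> (val p).2 != 0 ->
  (val p').1 ^+ 2 = (val p).1 ^+ 2 -> (val p').2 ^+ 2 = (val p).2 ^+ 2 ->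
  SU2_sim_op p' p.
Proof.
move=> a0 c0 aE cE; rewrite SU2_sim_sym; apply/SU2_simP.
by rewrite (negPf a0) (negPf c0).
Qed.

(** Let p be outside O.  If [sqdist] at p were below the threshold, some p' in O
    would have the same squares as p; for generic p this means p ~ p', against
    saturation.  Degenerate p are excluded by shrinking O to its generic part when
    q is generic, and handled by the second factor, which measures the distance
    to q itself, when q is degenerate. *)
Lemma separation (O : set (SU2 R)) q : open O -> O q ->
  (forall p p', SU2_sim_op p p' -> O p -> O p') ->
  exists2 x, (forall p, ~ O p -> rep_kernel (pi p) x) & ~ rep_kernel (pi q) x.
Proof.
move=> oO Oq satO; have [v v0] := irrep_nonzero (irr q).
have nz (e : R) : 0 < e -> (`|e - 0| + (e - 0))%:C != 0 :> R[i].
  move=> e0; rewrite subr0 gtr0_norm// -mulr2n; apply/eqP => /complexI/eqP.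
  by rewrite mulrn_eq0 (gt_eqF e0).
have bump0 (e : R) (z : R[i]) : 0 <= z -> ~ z < e%:C ->
    exists2 r, r%:C = z & (`|e - r| + (e - r))%:C = 0.
  move=> /nnegc_real[r r0 <-] /negP; rewrite ltcR -leNgt => er; exists r => //.
  by rewrite ler0_norm ?subr_le0// addNr.
have [bd|/eqP] := eqVneq ((val q).1 * (val q).2) 0; last first.
  move=> /eqP; rewrite mulf_eq0 negb_or => /andP[b0 d0].
  pose O' := O `&` ~` [set p | (val p).1 = 0] `&` ~` [set p | (val p).2 = 0].
  have oO' : open O'.
    apply: openI; first apply: openI => //.
      by apply: closed_openC; apply: closed_zeros; exact: SU2_fst_continuous.
    by apply: closed_openC; apply: closed_zeros; exact: SU2_snd_continuous.
  have [|e e0 eO] := @sqdist_near O' q oO'; first by split; [split|]; [|apply/eqP|apply/eqP].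
  have [u uP] := sqdist_bump (val q).1 (val q).2 e.
  exists u => [p Op w|uq].
    have [||r rE r0] := bump0 e (sqdist (val q).1 (val q).2 p).
    - by rewrite addr_ge0 ?exprn_ge0.
    - move=> /eO[p' [[[Op' /eqP a0] /eqP c0] aE cE]]; apply: Op.
      by apply: satO Op'; rewrite SU2_sim_sym; exact: sim_generic.
    - by rewrite (uP p r rE) r0 scale0r.
  have := uq v; rewrite (uP q 0).
    by move/eqP; rewrite scaler_eq0 (negPf (nz e e0)) => /eqP.
  by rewrite /sqdist !subrr normr0 expr0n addr0.
have [e e0 eO] := sqdist_near oO Oq.
have [e' e'0 e'O] := dist_near oO Oq.
have [u uP] := sqdist_bump (val q).1 (val q).2 e.
have [u' u'P] := dist_bump (val q).1 (val q).2 e'.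
exists (u * u') => [p Op w|uq].
  have [ac|ac] := eqVneq ((val p).1 * (val p).2) 0.
    have [||r rE r0] := bump0 e' (dist (val q).1 (val q).2 p).
    - by rewrite addr_ge0 ?exprn_ge0.
    - by move=> /e'O.
    - by rewrite repM (u'P p r ac rE) r0 scale0r rep0r.
  move: ac; rewrite mulf_eq0 negb_or => /andP[a0 c0].
  have [||r rE r0] := bump0 e (sqdist (val q).1 (val q).2 p).
  - by rewrite addr_ge0 ?exprn_ge0.
  - move=> /eO[p' [Op' aE cE]]; apply: Op; apply: satO Op'.
    exact: sim_generic.
  - by rewrite repM (uP p r rE) r0 scale0r.
have := uq v; rewrite repM (uP q 0) ?(u'P q 0)//.
- rewrite scalerA => /eqP; rewrite scaler_eq0 mulf_eq0.
  by rewrite (negPf (nz e e0)) (negPf (nz e' e'0)) => /eqP.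
- by rewrite /dist !subrr normr0 expr0n addr0.
- by rewrite /sqdist !subrr normr0 expr0n addr0.
Qed.

End Separation.

(** * The homeomorphism *)

Section Homeomorphism.
Variables (R : realType) (A : cstarAlgType R) (alpha gamma : A).
Hypothesis A_univ : is_C_SUm1_2 alpha gamma.
Variable pi : forall q : SU2 R, representation A (Cn R (pi_dim q)).
Hypothesis pi_is : forall q, is_pi alpha gamma (pi q).
Hypothesis pi_irr : forall q, irreducible (pi q).
Let irr q := Irrep (pi_irr q).

Lemma prim_eq (P Q : Prim A) : sval P = sval Q -> P = Q.
Proof. by case: P Q => [I hI] [J hJ] /= IJ; apply: eq_exist. Qed.

Lemma prim_of_pi (P : Prim A) : exists q, P = prim_of_irrep (irr q).
Proof.
have [p Pp] := svalP P; have [q qp] := irrep_classification A_univ pi_is p.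
by exists q; apply: prim_eq; rewrite Pp /= (unitary_equiv_kernel qp).
Qed.

(** A Jacobson closed set is the hull of its kernel, an intersection of sets as in
    [closed_kernel]. *)
Lemma prim_open_SU2_open (V : set (Prim A)) : open V ->
  open [set q | V (prim_of_irrep (irr q))].
Proof.
move=> oV; have VE : hull_kernel (~` V) = ~` V := oV.
rewrite -[X in open X]setCK; apply: closed_openC.
have TP (q : SU2 R) : exists rho : representation A (Cn R 2),
    acts_by alpha gamma (alpha_mx (val q).1) (gamma_mx (val q).2) rho.
  have [rho rhoP] := matrix_representation A_univ (SUm1_relations_mx (SU2_norm q)).
  by exists rho.
pose T q := sval (cid (TP q)).
have T1 q v : T q 1 v = v by case: (svalP (cid (TP q))).
have Talpha q v : T q alpha v = alpha_mx (val q).1 *m v.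
  by case: (svalP (cid (TP q))).
have Tgamma q v : T q gamma v = gamma_mx (val q).2 *m v.
  by case: (svalP (cid (TP q))).
rewrite (_ : ~` _ = \bigcap_(x in \bigcap_(Q in ~` V) sval Q)
    [set q | rep_kernel (pi q) x]).
  by apply: closed_bigI => x _; exact: (closed_kernel A_univ T1 Talpha Tgamma pi_is).
apply/seteqP; split=> q.
  move=> nV x xI; have h : hull_kernel (~` V) (prim_of_irrep (irr q)) by rewrite VE.
  exact: (h x xI).
move=> h; suff : hull_kernel (~` V) (prim_of_irrep (irr q)) by rewrite VE.
by move=> x xI; exact: (h x xI).
Qed.

(** [separation] says that no point of O lies in the hull-kernel closure of the
    complement. *)
Lemma SU2_open_prim_open (O : set (SU2 R)) : open O ->
  (forall p p', SU2_sim_op p p' -> O p -> O p') ->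
  open [set P | exists2 q, P = prim_of_irrep (irr q) & O q].
Proof.
move=> oO satO; set V := [set _ | _]; suff : jacobson_open V by [].
apply/jacobson_openP => P hP [q PE Oq].
have [x x0 xq] := separation A_univ pi_is pi_irr oO Oq satO.
apply: xq; have : sval P x; last by rewrite PE.
apply: hP => Q; have [q' ->] := prim_of_pi Q => nV; apply: x0 => Oq'.
by apply: nV; exists q'.
Qed.

Definition Pi_map (x : SU2_quot R) : spectrum A :=
  irrep_class (irr (repr (x : {eq_quot SU2_sim R}))).

Lemma irrep_class_sim q q' : SU2_sim_op q q' ->
  irrep_class (irr q) = irrep_class (irr q').
Proof. by move=> qq'; apply/irrep_classP; exact: (pi_sim_equiv A_univ pi_is pi_irr qq'). Qed.

Lemma Pi_mapE q : Pi_map (\pi_(SU2_quot R) q) = irrep_class (irr q).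
Proof.
apply: irrep_class_sim.
have /eqmodP : (repr (\pi_({eq_quot SU2_sim R}) q) = q %[mod {eq_quot SU2_sim R}]).
  by rewrite reprK.
by [].
Qed.

Lemma Pi_map_homeomorphism : homeomorphism_onto_spectrum Pi_map.
Proof.
have kernel_class q q' : rep_kernel (pi q) = rep_kernel (pi q') ->
    irrep_class (irr q) = irrep_class (irr q').
  by move=> /(pi_kernel_sim pi_is pi_irr)/irrep_class_sim.
have surj s : exists x, Pi_map x = s.
  case: s => S [p Sp]; have [q qp] := irrep_classification A_univ pi_is p.
  exists (\pi_(SU2_quot R) q); rewrite Pi_mapE; subst S.
  by transitivity (irrep_class p); [apply/irrep_classP|apply: eq_exist].
split.
  have inj : injective Pi_map.
    move=> x y; rewrite -[x]reprK -[y]reprK !Pi_mapE => /irrep_classP xy.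
    apply/eqmodP; apply: (pi_kernel_sim pi_is pi_irr).
    exact: (unitary_equiv_kernel xy).
  exists (fun s => sval (cid (surj s))) => [x|s]; last exact: svalP (cid (surj s)).
  by apply: inj; exact: svalP (cid (surj (Pi_map x))).
move=> U; have -> : open [set x | U (Pi_map x)] = open [set q | U (irrep_class (irr q))].
  have -> : [set q | U (irrep_class (irr q))] =
      \pi_(SU2_quot R) @^-1` [set x | U (Pi_map x)].
    by apply/seteqP; split=> q /=; rewrite Pi_mapE.
  by [].
split=> [oU|[V oV UV]].
  exists [set P | exists2 q, P = prim_of_irrep (irr q) & U (irrep_class (irr q))].
    by apply: SU2_open_prim_open => // p p' /irrep_class_sim ->.
  move=> p; have [q qp] := irrep_classification A_univ pi_is p.
  have pE : irrep_class p = irrep_class (irr q).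
    by apply/irrep_classP/unitary_equiv_sym.
  rewrite pE; split=> [Uq|[q' qE Uq']].
    by exists q => //; apply: prim_eq; rewrite /= (unitary_equiv_kernel qp).
  rewrite (kernel_class q q')//.
  by have /(congr1 sval) /= <- := qE; exact: unitary_equiv_kernel.
rewrite (_ : [set q | _] = [set q | V (prim_of_irrep (irr q))]).
  exact: prim_open_SU2_open.
by apply/seteqP; split=> q /=; apply UV.
Qed.

End Homeomorphism.

Theorem theorem2p1 (R : realType) (A : cstarAlgType R) (alpha gamma : A)
    (A_univ : is_C_SUm1_2 alpha gamma) :
  exists pi : forall p : SU2 R, representation A (Cn R (pi_dim p)),
  exists pi_irr : forall p : SU2 R, irreducible (pi p),
    (forall p : SU2 R, is_pi alpha gamma (pi p)) /\
    exists Pi : SU2_quot R -> spectrum A,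
      (forall p : SU2 R, Pi (\pi_(SU2_quot R) p) = irrep_class (Irrep (pi_irr p))) /\
      homeomorphism_onto_spectrum Pi.
Proof.
pose pi p := sval (cid (pi_exists A_univ p)).
have pi_is p : is_pi alpha gamma (pi p) := svalP (cid (pi_exists A_univ p)).
exists pi, (fun p => pi_irreducible (pi_is p)); split=> //.
exists (Pi_map (fun p => pi_irreducible (pi_is p))); split=> [p|].
  exact: (Pi_mapE A_univ pi_is).
exact: (Pi_map_homeomorphism A_univ pi_is).
Qed.
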